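(* Let $d \geq 1$ be an integer. There exists a constant $E > 0$, depending only on $d$, such that the following holds. Let $C \geq 1$ be a real number, let $t > d$ be an integer, and let $s > d + t$ be a real number. For each $k \in \mathbb{Z}^d$ let $f_k : \mathbb{R}^d \to \mathbb{C}$ be a measurable function such that $$|f_k(x)| \leq C\,(1+|x-k|)^{-s}, \qquad x \in \mathbb{R}^d.$$ Suppose that $\{f_k\}_{k\in\mathbb{Z}^d}$ is a Riesz basis, with bounds $0 < A \leq B < \infty$, of its closed linear span $S$ within $L^2(\mathbb{R}^d)$, and let $\{g_k\}_{k \in \mathbb{Z}^d} \subseteq S$ be its dual basis. Then for every $k \in \mathbb{Z}^d$ the dual function $g_k$ satisfies $$|g_k(x)| \leq D\,(1+|x-k|)^{-t} \qquad \text{for almost every } x \in \mathbb{R}^d$$ (that is, the $L^2$ element $g_k$ has a representative satisfying this bound for all $x \in \mathbb{R}^d$), where $$D = \frac{E^{t^2}\, C^{2t+1}}{A^{t+1}} \left(1 + \frac{1}{s-t-d}\right)^{t}.$$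
   Context: $|\cdot|$ denotes the max-norm on $\mathbb{R}^d$: $|x| = \max\{|x_1|,\dots,|x_d|\}$. The family $\{f_k\}_{k\in\mathbb{Z}^d}$ is a Riesz basis of its closed linear span $S \subseteq L^2(\mathbb{R}^d)$ with bounds $0<A\le B<\infty$ if for every $c = (c_k)_k \in \ell^2(\mathbb{Z}^d)$ the series $\sum_k c_k f_k$ converges unconditionally in $L^2(\mathbb{R}^d)$ and $$A \|c\|_{\ell^2}^2 \leq \Big\| \sum_{k} c_k f_k \Big\|_{L^2}^2 \leq B \|c\|_{\ell^2}^2 .$$ The dual basis $\{g_k\}_{k \in \mathbb{Z}^d}$ is the unique family of elements of $S$ satisfying the biorthogonality relation $\langle g_k, f_j\rangle = \delta_{k,j}$ for all $k,j \in \mathbb{Z}^d$, where $\langle\cdot,\cdot\rangle$ is the $L^2(\mathbb{R}^d)$ inner product. *)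

(* Defs.v *)
From HB Require Import structures.
From mathcomp Require Import all_boot all_order all_algebra.
From mathcomp Require Import finmap.
From mathcomp Require Import all_classical all_reals all_analysis.
From mathcomp Require Import complex.

Set Implicit Arguments.
Unset Strict Implicit.
Unset Printing Implicit Defensive.
Import Order.TTheory GRing.Theory Num.Theory.
Import numFieldNormedType.Exports.
Import Normc.

Local Open Scope classical_set_scope.
Local Open Scope ring_scope.

Lemma product_measure_sigma_finite (d1 d2 : measure_display)
    (T1 : measurableType d1) (T2 : measurableType d2) (R : realType)
    (m1 : {sigma_finite_measure set T1 -> \bar R})
    (m2 : {sigma_finite_measure set T2 -> \bar R}) :
  sigma_finite setT (m1 \x m2)%E.
Proof.
have /sigma_finiteP[F [TF ndF Foo]] := sigma_finiteT m1.
have /sigma_finiteP[G [TG ndG Goo]] := sigma_finiteT m2.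
exists (fun n => F n `*` G n).
  rewrite -setXTT TF TG; apply/seteqP; split=> [[x y] /=|[x y] [n _ [/= ? ?]]].
    move=> [[i _ Fix] [j _ Gjy]]; exists (maxn i j) => //; split => /=.
    - by move: x Fix; exact/subsetPset/ndF/leq_maxl.
    - by move: y Gjy; exact/subsetPset/ndG/leq_maxr.
  by split; exists n.
move=> k; have [? ?] := Foo k; have [? ?] := Goo k.
split; first exact: measurableX.
by rewrite product_measure1E// lte_mul_pinfty// ge0_fin_numE.
Qed.

Section tuple_cons_measure.
Context {disp : measure_display} {T : measurableType disp} {R : realType}.
Variables (n : nat) (nu : {sigma_finite_measure set T -> \bar R}).
Variable mu : {sigma_finite_measure set (n.-tuple T) -> \bar R}.
Local Open Scope ereal_scope.

Definition tuple_cons (p : T * n.-tuple T) : n.+1.-tuple T :=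
  [tuple of p.1 :: p.2].

Definition tuple_uncons (x : n.+1.-tuple T) : T * n.-tuple T :=
  (tnth x ord0, [tuple of behead x]).

Lemma tuple_consK : cancel tuple_cons tuple_uncons.
Proof. by case=> a x; congr pair; exact/val_inj. Qed.

Lemma measurable_tuple_cons : measurable_fun setT tuple_cons.
Proof. exact: measurable_cons. Qed.

Lemma measurable_tuple_uncons : measurable_fun setT tuple_uncons.
Proof.
by apply: measurable_fun_pair;
  [exact: measurable_tnth|exact: measurable_behead].
Qed.

Definition tuple_cons_measure : set (n.+1.-tuple T) -> \bar R :=
  pushforward (nu \x mu) tuple_cons.

Let m : {measure set (n.+1.-tuple T) -> \bar R} :=
  measure_function_pushforward__canonical__measure_function_Measure
    (nu \x mu) measurable_tuple_cons.

Let tcm0 : tuple_cons_measure set0 = 0.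
Proof. exact: (measure0 m). Qed.

Let tcm_ge0 A : 0 <= tuple_cons_measure A.
Proof. exact: (measure_ge0 m). Qed.

Let tcm_sigma_additive : semi_sigma_additive tuple_cons_measure.
Proof. exact: (@measure_semi_sigma_additive _ _ _ m). Qed.

HB.instance Definition _ := isMeasure.Build _ _ _ tuple_cons_measure
  tcm0 tcm_ge0 tcm_sigma_additive.

Let tcm_sigma_finite : sigma_finite setT tuple_cons_measure.
Proof.
have [F TF Foo] := product_measure_sigma_finite nu mu.
exists (fun k => tuple_uncons @^-1` F k).
  by rewrite -preimage_bigcup -TF preimage_setT.
move=> k; have [mF Fk] := Foo k; split.
  by rewrite -[X in measurable X]setTI; exact: measurable_tuple_uncons.
rewrite /tuple_cons_measure /pushforward -comp_preimage.
by rewrite (_ : _ \o _ = id)//; apply/funext => x /=; rewrite tuple_consK.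
Qed.

HB.instance Definition _ := Measure_isSigmaFinite.Build _ _ _
  tuple_cons_measure tcm_sigma_finite.

End tuple_cons_measure.

Section tuple_measure.
Context {disp : measure_display} {T : measurableType disp} {R : realType}.
Variable nu : {sigma_finite_measure set T -> \bar R}.

Fixpoint tuple_measure (n : nat) :
    {sigma_finite_measure set (n.-tuple T) -> \bar R} :=
  match n with
  | 0 => \d_([tuple] : 0.-tuple T)
  | n'.+1 => tuple_cons_measure nu (tuple_measure n')
  end.

Lemma measurable_tuple_box (n : nat) (A : 'I_n -> set T) :
  (forall i, measurable (A i)) ->
  measurable [set x : n.-tuple T | forall i, A i (tnth x i)].
Proof.
move=> mA; rewrite (_ : mkset _ =
    \bigcap_(i in setT) ((fun x : n.-tuple T => tnth x i) @^-1` A i)); last first.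
  by apply/seteqP; split=> [x Ax i _|x Ax i]; exact: Ax.
apply: fin_bigcap_measurable => [|i _]; first exact: finite_finset.
rewrite -[X in measurable X]setTI.
exact: measurable_tnth.
Qed.

Lemma tuple_measure_box (n : nat) (A : 'I_n -> set T) :
  (forall i, measurable (A i)) ->
  tuple_measure n [set x | forall i, A i (tnth x i)] =
  (\prod_(i < n) nu (A i))%E.
Proof.
elim: n A => [|n IH] A mA.
  by rewrite big_ord0 /= diracE mem_set// => -[].
rewrite big_ord_recl -(IH (fun i => A (lift ord0 i)))//.
rewrite -product_measure1E//; last first.
  exact: (measurable_tuple_box (fun i => mA (lift ord0 i))).
congr (product_measure1 _ _ _).
apply/seteqP; split=> [[a x] /= Ax|[a x] /= [Aa Ax] i].
  split=> /= [|i]; first exact: Ax ord0.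
  by have := Ax (lift ord0 i); rewrite tnthS.
by case: (unliftP ord0 i) => [j|] -> //; rewrite tnthS; exact: Ax.
Qed.

End tuple_measure.

Section euclidean.
Variables (R : realType) (d : nat).

Definition borel_lebesgue :
    {sigma_finite_measure set (d.-tuple (measurableTypeR R)) -> \bar R} :=
  tuple_measure (@lebesgue_measure R) d.

(* R^d with the sigma-algebra of all Lebesgue-measurable sets (not only the
   Borel ones), obtained as the Caratheodory sets of the outer measure induced
   by borel_lebesgue; lebesgue below is therefore a complete measure. *)
Definition euclidean : measurableType (borel_lebesgue^*)%mu.-cara :=
  caratheodory_type (borel_lebesgue^*)%mu.

Definition lebesgue : {measure set euclidean -> \bar R} :=
  @completed_measure_extension _ _ R borel_lebesgue.

Lemma lebesgue_box (A : 'I_d -> set (measurableTypeR R)) :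
  (forall i, measurable (A i)) ->
  lebesgue [set x : euclidean | forall i, A i (tnth x i)] =
  (\prod_(i < d) lebesgue_measure (A i))%E.
Proof.
move=> mA; rewrite -(tuple_measure_box (@lebesgue_measure R) mA).
apply: (measurable_mu_extE borel_lebesgue).
exact: (measurable_tuple_box mA).
Qed.

Definition lattice : choiceType := {ffun 'I_d -> int}.

Definition max_dist (x : euclidean) (k : lattice) : R :=
  \big[Num.max/0]_(i < d) `|(tnth x i : R) - (k i)%:~R|.

Implicit Types (u v h : euclidean -> R[i]) (f g : lattice -> euclidean -> R[i]).

Definition cmeasurable u :=
  measurable_fun setT (fun x => complex.Re (u x)) /\
  measurable_fun setT (fun x => complex.Im (u x)).

Definition L2norm u : \bar R :=
  Lnorm lebesgue 2%:E (fun x => (normc (u x))%:E).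

Definition L2 u := cmeasurable u /\ (L2norm u < +oo)%E.

Definition L2inner u v : R[i] :=
  Complex (\int[lebesgue]_x complex.Re (u x * (v x)^*%C))
          (\int[lebesgue]_x complex.Im (u x * (v x)^*%C)).

Definition ell2norm_sqr (c : lattice -> R[i]) : \bar R :=
  \esum_(k in setT) ((normc (c k)) ^+ 2)%:E.

Definition finite_comb f (c : lattice -> R[i]) (J : {fset lattice}) :
    euclidean -> R[i] :=
  fun x => \sum_(k <- J) c k * f k x.

Definition closed_span f : set (euclidean -> R[i]) :=
  [set h | L2 h /\ forall e : R, 0 < e ->
     exists (c : lattice -> R[i]) (J : {fset lattice}),
       (L2norm (h \- finite_comb f c J)%R < e%:E)%E].

(* Unconditional convergence of the series to h in L^2, as convergence of the
   net of partial sums over finite subsets of the lattice ordered by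
   inclusion. *)
Definition unconditional_sum f (c : lattice -> R[i]) h :=
  L2 h /\ forall e : R, 0 < e -> exists J0 : {fset lattice},
    forall J : {fset lattice}, (J0 `<=` J)%fset ->
      (L2norm (h \- finite_comb f c J)%R < e%:E)%E.

(* Functions represent elements of L^2: the limit h is unique only up to
   almost-everywhere equality, which does not affect L2norm h. *)
Definition riesz_basis f (A B : R) :=
  [/\ 0 < A, A <= B, (forall k, L2 (f k)) &
    forall c : lattice -> R[i], (ell2norm_sqr c < +oo)%E ->
      exists2 h, unconditional_sum f c h &
        (A%:E * ell2norm_sqr c <= L2norm h ^+ 2)%E /\
        (L2norm h ^+ 2 <= B%:E * ell2norm_sqr c)%E].

Definition dual_basis f g :=
  (forall k, closed_span f (g k)) /\
  (forall k j, L2inner (g k) (f j) = (k == j)%:R).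

End euclidean.

(* Main.v *)
Require Import Defs.
From HB Require Import structures.
From mathcomp Require Import all_boot all_order all_algebra.
From mathcomp Require Import finmap.
From mathcomp Require Import all_classical all_reals all_analysis.
From mathcomp Require Import measurable_realfun.
From mathcomp Require Import complex lra ring zify.
Set Implicit Arguments.
Unset Strict Implicit.
Unset Printing Implicit Defensive.
Import Order.TTheory GRing.Theory Num.Theory.
Import numFieldNormedType.Exports.
Import Normc.
Local Open Scope classical_set_scope.
Local Open Scope ring_scope.

(** The dual function g_k is the L^2 limit of dual functions of finite
    subfamilies. If J is a finite set of indices containing k, the orthogonal
    projection h_J of g_k onto the span of (f_j), j in J, still satisfies
    <h_J, f_j> = delta_kj for j in J, so its coefficients form the k-th column
    of the inverse of the finite Gram matrix G of (f_j), j in J. As g_k belongs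
    to the closed span, h_J is as close to g_k in L^2 as desired when J is
    large. It is therefore enough to bound |h_J| pointwise by
    D (1 + |x - k|)^(-t) with D independent of J: the positive part of
    |g_k| - D (1 + |x - k|)^(-t) is then at most |g_k - h_J|, hence has
    arbitrarily small L^2 norm, and vanishes almost everywhere
    ([ae_normc_le]). All linear algebra is thus finite dimensional.

    The bound on a column v of the inverse of G comes from commuting with
    coordinates ([inverse_column_decay]). The identity G v = delta and the
    binomial expansion of (p_i - k_i)^n around an intermediate index q show
    that w_n = (q_i - k_i)^n v_q satisfies
      G w_n = - sum_(1 <= a <= n) 'C(n, a) (G^(a) w_(n - a)),
    where G^(a) has the entries (p_i - q_i)^a G_pq. The lower Riesz bound says
    that G is coercive with constant A, and the Schur test bounds every G^(a)
    by one constant gamma >= A, for a <= t. An induction gives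
    |w_t| <= 2^(t^2) (gamma / A)^t / A. Since gamma is of the form
    const(d) 2^t C^2 (1 + 1 / (s - t - d)) ([gram_moment]), this gives the
    exponents t^2 of E, t + 1 of A and 2 t of C; the last factor C appears when
    the coefficients are summed against the f_j.

    A single factor 1 + 1 / (s - t - d) in gamma requires some care: in
      |p - q|^a <= 2^t ((1 + |x - p|)^t + (1 + |x - q|)^t)
    the weight t is spent on only one of the two decaying factors, so that the
    other one keeps the exponent s >= d + 1 and contributes a constant
    depending on d only. Both the sum over the lattice and the integral over
    R^d of (1 + |x - k|)^(-p) are bounded by const(d) (1 + 1 / (p - d)); a
    product of one-dimensional estimates would give the power d of the second
    factor, so the proof cuts space into dyadic shells
    ([sum_powRN_supdist_le], [integral_powRN_le]).

    Complex coefficients are avoided by replacing (f_j) with the real family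
    f_j, i f_j and by using the real part of the inner product; this doubles
    the index set and changes neither spans nor norms. *)

(** * Off-diagonal decay of solutions of coercive linear systems *)

Section matrix_decay.
Variables (R : rcfType) (I : finType).
Implicit Types (x y w : I -> R) (G H : I -> I -> R).

Definition l2norm x := Num.sqrt (\sum_p x p ^+ 2).

Lemma l2norm_ge0 x : 0 <= l2norm x.
Proof. exact: sqrtr_ge0. Qed.

Lemma sqr_l2norm x : l2norm x ^+ 2 = \sum_p x p ^+ 2.
Proof. by rewrite sqr_sqrtr// sumr_ge0// => p _; exact: sqr_ge0. Qed.

Lemma le_l2norm x p : `|x p| <= l2norm x.
Proof.
rewrite -[leLHS]sqrtr_sqr ler_wsqrtr// (bigD1 p)//= lerDl.
by rewrite sumr_ge0// => q _; exact: sqr_ge0.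
Qed.

Lemma l2norm_eq0 x : l2norm x = 0 -> forall p, x p = 0.
Proof.
by move=> x0 p; apply/eqP; rewrite -normr_le0 -x0 le_l2norm.
Qed.

(** Sum the inequality 2 X Y |x_p y_q| <= Y^2 x_p^2 + X^2 y_q^2, weighted by
    |H p q| and with X, Y the norms of x and y: rows control the first term
    and columns the second. *)
Lemma schur_test H (gam : R) x y :
  (forall p, \sum_q `|H p q| <= gam) -> (forall q, \sum_p `|H p q| <= gam) ->
  `|\sum_p x p * \sum_q H p q * y q| <= gam * l2norm x * l2norm y.
Proof.
move=> rowH colH; set X := l2norm x; set Y := l2norm y.
have X0 : 0 <= X := l2norm_ge0 x; have Y0 : 0 <= Y := l2norm_ge0 y.
have [Xz|Xn] := eqVneq X 0.
  rewrite big1 ?normr0 ?Xz ?mulr0 ?mul0r// => p _.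
  by rewrite (l2norm_eq0 Xz) mul0r.
have [Yz|Yn] := eqVneq Y 0.
  rewrite big1 ?normr0 ?Yz ?mulr0 ?mul0r// => p _.
  by rewrite big1 ?mulr0// => q _; rewrite (l2norm_eq0 Yz) mulr0.
have XY0 : 0 < X * Y by rewrite mulr_gt0// lt_neqAle eq_sym ?Xn ?Yn.
suff : 2 * (X * Y) * `|\sum_p x p * \sum_q H p q * y q|
       <= 2 * (X * Y) * (gam * X * Y) by rewrite ler_pM2l// mulr_gt0.
apply: (@le_trans _ _
  (\sum_p \sum_q (Y ^+ 2 * x p ^+ 2 * `|H p q| + X ^+ 2 * y q ^+ 2 * `|H p q|))).
  rewrite -[X in X * `|_|]ger0_norm ?mulr_ge0// -normrM mulr_sumr.
  apply: le_trans (ler_norm_sum _ _ _) _; apply: ler_sum => p _.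
  rewrite !mulr_sumr; apply: le_trans (ler_norm_sum _ _ _) _.
  apply: ler_sum => q _; rewrite -mulrDl.
  rewrite (_ : 2 * _ * _ = (2 * (Y * x p) * (X * y q)) * H p q); last by ring.
  rewrite normrM ler_wpM2r// -!exprMn.
  set a := Y * x p; set b := X * y q.
  rewrite ler_norml; apply/andP; split.
    by have := sqr_ge0 (a + b); nra.
  by have := sqr_ge0 (a - b); nra.
under eq_bigr do rewrite big_split.
rewrite big_split/= [X in _ + X]exchange_big/=.
rewrite (_ : 2 * _ * _ = Y ^+ 2 * X ^+ 2 * gam + X ^+ 2 * Y ^+ 2 * gam);
  last by ring.
apply: lerD.
  rewrite [X ^+ 2]sqr_l2norm mulr_sumr mulr_suml; apply: ler_sum => p _.
  by rewrite -mulr_sumr ler_wpM2l// mulr_ge0 ?sqr_ge0.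
rewrite [Y ^+ 2]sqr_l2norm mulr_sumr mulr_suml; apply: ler_sum => q _.
by rewrite -mulr_sumr ler_wpM2l// mulr_ge0 ?sqr_ge0.
Qed.

Definition coercive (A : R) G :=
  forall x, A * l2norm x ^+ 2 <= \sum_p x p * \sum_q G p q * x q.

(** A coercive matrix has trivial kernel, hence is invertible. *)
Lemma coercive_solve A G (e : I -> R) : 0 < A -> coercive A G ->
  exists v, forall p, \sum_q G p q * v q = e p.
Proof.
move=> A0 cG; pose M := \matrix_(i < #|I|, j < #|I|) G (enum_val j) (enum_val i).
have Munit : M \in unitmx.
  rewrite -row_free_unit; apply: inj_row_free => u uM.
  pose x p := u 0 (enum_rank p).
  have Gx p : \sum_q G p q * x q = 0.
    have := congr1 (fun z : 'rV_#|I| => z 0 (enum_rank p)) uM.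
    rewrite !mxE => uMp; rewrite -[RHS]uMp (reindex_onto enum_val enum_rank)/=; last first.
      by move=> i _; rewrite enum_rankK.
    apply: eq_big => [i|i _]; first by rewrite enum_valK eqxx.
    by rewrite /M mxE enum_rankK mulrC /x enum_valK.
  have x0 : l2norm x ^+ 2 <= 0.
    rewrite -(pmulr_rle0 _ A0); apply: le_trans (cG x) _.
    by rewrite big1// => p _; rewrite Gx mulr0.
  have {}x0 : l2norm x = 0.
    by apply/eqP; rewrite -sqrf_eq0 eq_le x0 sqr_ge0.
  apply/rowP => j; rewrite !mxE -(enum_valK j); exact: l2norm_eq0 x0 _.
pose u := \row_j e (enum_val j) *m invmx M.
exists (fun p => u 0 (enum_rank p)) => p.
have := congr1 (fun z : 'rV_#|I| => z 0 (enum_rank p))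
  (mulmxKV Munit (\row_j e (enum_val j))).
rewrite -/u !mxE enum_rankK => <-.
rewrite [RHS](reindex_onto enum_rank enum_val)/=; last first.
  by move=> i _; rewrite enum_valK.
apply: eq_big => [q|q _]; first by rewrite enum_rankK eqxx.
by rewrite [M _ _]mxE !enum_rankK mulrC.
Qed.

Section decay.
Variables (G : I -> I -> R) (A gam : R) (pos : I -> R) (t : nat) (p0 : I).
Variable v : I -> R.
Hypothesis A0 : 0 < A.
Hypothesis cG : coercive A G.
Hypothesis symG : forall p q, G p q = G q p.
Hypothesis momentG : forall a p, (a <= t)%N ->
  \sum_q `|pos p - pos q| ^+ a * `|G p q| <= gam.
Hypothesis Gv : forall p, \sum_q G p q * v q = (p == p0)%:R.

Let w n p := (pos p - pos p0) ^+ n * v p.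

(** Test coercivity on the basis vector at p0. Comparing A with the moment
    bound makes gam / A at least 1, so that lower powers of it can be replaced
    with higher ones. *)
Lemma coercive_le_moment : A <= gam.
Proof.
apply: le_trans (momentG p0 (leq0n t)).
pose x p : R := (p == p0)%:R.
have := cG x; rewrite sqr_l2norm.
rewrite (bigD1 p0)//= big1 ?addr0; last first.
  by move=> p /negPf pp0; rewrite /x pp0 expr0n.
rewrite /x eqxx expr1n mulr1 => /le_trans; apply.
rewrite (bigD1 p0)//= [X in _ + X]big1 ?addr0; last first.
  by move=> p /negPf pp0; rewrite pp0 mul0r.
rewrite eqxx mul1r; apply: ler_sum => q _; rewrite expr0 mul1r.
by case: eqP => _; rewrite ?mulr1 ?mulr0 ?ler_norm.
Qed.

Let gam0 : 0 < gam.
Proof. exact: lt_le_trans A0 coercive_le_moment. Qed.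

(** Expand (pos p - pos p0)^n = ((pos p - pos q) + (pos q - pos p0))^n inside
    the p-th equation of the system: its right-hand side is supported at p0,
    where the factor (pos p - pos p0)^n kills it, and the term with exponent 0
    on pos p - pos q is the left-hand side below. *)
Lemma leibniz n p : (0 < n)%N ->
  \sum_q G p q * w n q =
  - \sum_(a < n) 'C(n, a.+1)%:R *
      \sum_q (pos p - pos q) ^+ a.+1 * G p q * w (n - a.+1) q.
Proof.
move=> n0; apply/eqP; rewrite -addr_eq0; apply/eqP.
transitivity ((pos p - pos p0) ^+ n * \sum_q G p q * v q); last first.
  rewrite Gv; case: eqP => [->|_]; last by rewrite mulr0.
  by rewrite subrr expr0n eqn0Ngt n0 mul0r.
rewrite mulr_sumr; under [RHS]eq_bigr => q _.
  rewrite (_ : pos p - pos p0 = (pos q - pos p0) + (pos p - pos q)); last by ring.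
  rewrite exprDn big_ord_recl/= bin0 subn0 expr0 mulr1 mulr1n mulrDl mulr_suml.
  over.
rewrite big_split/=; congr (_ + _).
  by apply: eq_bigr => q _; rewrite mulrCA.
rewrite exchange_big/=; apply: eq_bigr => a _.
rewrite mulr_sumr; apply: eq_bigr => q _.
rewrite /w -mulr_natl /bump/= add1n; ring.
Qed.

(** Pair the Leibniz identity with w n itself: coercivity bounds the left-hand
    side from below and the Schur test bounds each term on the right. *)
Lemma moment_step n : (0 < n <= t)%N ->
  A * l2norm (w n) <= gam * \sum_(a < n) 'C(n, a.+1)%:R * l2norm (w (n - a.+1)).
Proof.
move=> /andP[n0 nt]; set W := l2norm (w n).
have sum0 : 0 <= \sum_(a < n) 'C(n, a.+1)%:R * l2norm (w (n - a.+1)).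
  by rewrite sumr_ge0// => a _; rewrite mulr_ge0 ?l2norm_ge0.
have [->|Wn0] := eqVneq W 0; first by rewrite mulr0 mulr_ge0// ltW.
have W0 : 0 < W by rewrite lt_neqAle eq_sym Wn0 l2norm_ge0.
rewrite -(ler_pM2r W0) -mulrA -expr2; apply: le_trans (cG (w n)) _.
under eq_bigr do rewrite leibniz// mulrN mulr_sumr.
rewrite sumrN; apply: le_trans (ler_norm _) _; rewrite normrN exchange_big/=.
apply: le_trans (ler_norm_sum _ _ _) _.
rewrite mulr_sumr mulr_suml; apply: ler_sum => a _.
under eq_bigr do rewrite mulrCA.
rewrite -mulr_sumr normrM ger0_norm//.
have le_at : (a.+1 <= t)%N by rewrite (leq_trans _ nt).
have row p : \sum_q `|(pos p - pos q) ^+ a.+1 * G p q| <= gam.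
  apply: le_trans (momentG p le_at); apply: ler_sum => q _.
  by rewrite normrM normrX.
rewrite (_ : _ * _ * W = 'C(n, a.+1)%:R * (gam * W * l2norm (w (n - a.+1)))); last by ring.
rewrite ler_wpM2l// schur_test// => q.
apply: le_trans (row q); apply: ler_sum => p _.
by rewrite symG !normrM !normrX distrC.
Qed.

(** The factor 2^(n^2) solves the recursion of [moment_step], since
    (2^(n+1) - 1) 2^(n^2) <= 2^((n+1)^2). *)
Lemma moment_bound n : (n <= t)%N ->
  l2norm (w n) <= 2 ^+ (n ^ 2) * (gam / A) ^+ n / A.
Proof.
have gA1 : 1 <= gam / A by rewrite ler_pdivlMr ?mul1r ?coercive_le_moment.
elim/ltn_ind: n => -[|n] IH nt.
  rewrite exp0n// !expr0 !mul1r -[A^-1]mul1r ler_pdivlMr//.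
  rewrite mulrC; have [->|Wn0] := eqVneq (l2norm (w 0)) 0; first by rewrite mulr0 ler01.
  have W0 : 0 < l2norm (w 0) by rewrite lt_neqAle eq_sym Wn0 l2norm_ge0.
  rewrite -(ler_pM2r W0) -mulrA -expr2 mul1r; apply: le_trans (cG (w 0)) _.
  have Gw0 p : \sum_q G p q * w 0 q = (p == p0)%:R.
    by rewrite -(Gv p); apply: eq_bigr => q _; rewrite /w expr0 mul1r.
  rewrite (bigD1 p0)//= [X in _ + X]big1 ?addr0; last first.
    by move=> p /negPf pp0; rewrite Gw0 pp0 mulr0.
  rewrite Gw0 eqxx mulr1; exact: le_trans (ler_norm _) (le_l2norm _ _).
rewrite ler_pdivlMr// mulrC; apply: le_trans (@moment_step n.+1 nt) _.
apply: (@le_trans _ _ (gam * \sum_(a < n.+1) 'C(n.+1, a.+1)%:R *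
    (2 ^+ (n ^ 2) * (gam / A) ^+ n / A))).
  rewrite ler_pM2l//; apply: ler_sum => a _; rewrite ler_wpM2l//.
  apply: le_trans (IH _ _ _) _; rewrite ?subSS ?ltnS ?leq_subr//.
    by rewrite (leq_trans (leq_subr _ _))// ltnW.
  have lan : (n - a <= n)%N by rewrite leq_subr.
  rewrite ler_pM2r ?invr_gt0// ler_pM ?exprn_ge0 ?ler_weXn2l//;
    by rewrite ?leq_sqr// ?(le_trans ler01)// ler1n.
rewrite -mulr_suml -natr_sum.
have -> : (\sum_(a < n.+1) 'C(n.+1, a.+1) = 2 ^ n.+1 - 1)%N.
  rewrite -[2%N]/(1 + 1)%N expnDn [in RHS]big_ord_recl/= bin0 !exp1n !muln1 addKn.
  by apply: eq_bigr => a _; rewrite /bump/= !exp1n !muln1 add1n.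
rewrite (_ : gam * _ =
  ((2 ^ n.+1 - 1)%:R * 2 ^+ (n ^ 2)) * (gam / A) ^+ n.+1); last first.
  by rewrite exprS; ring.
rewrite ler_wpM2r ?exprn_ge0 ?(le_trans ler01)//.
rewrite -natrX -natrM -natrX ler_nat.
apply: (@leq_trans (2 ^ n.+1 * 2 ^ n ^ 2)); first by rewrite leq_mul// leq_subr.
rewrite -expnD leq_exp2l// -[in leqRHS]addn1 sqrnD muln1 addnC -addnA leq_add2l.
by rewrite mul2n -addnn exp1n -addn1 addnC leq_add2l leq_addr.
Qed.

End decay.

(** Polynomial decay of a column of the inverse of G away from its diagonal
    entry, in the style of Jaffard, from the moments of G up to order t
    alone. *)
Lemma inverse_column_decay G (A gam : R) (pos : I -> R) t p0 v :
  0 < A -> coercive A G -> (forall p q, G p q = G q p) ->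
  (forall a p, (a <= t)%N -> \sum_q `|pos p - pos q| ^+ a * `|G p q| <= gam) ->
  (forall p, \sum_q G p q * v q = (p == p0)%:R) ->
  forall p, `|pos p - pos p0| ^+ t * `|v p| <= 2 ^+ (t ^ 2) * gam ^+ t / A ^+ t.+1.
Proof.
move=> A0 cG symG momG Gv p.
rewrite -normrX -normrM; apply: le_trans (le_l2norm (fun q => _ * v q) p) _.
apply: le_trans (moment_bound A0 cG symG momG Gv (leqnn t)) _.
by rewrite expr_div_n exprSr invfM !mulrA.
Qed.

End matrix_decay.

(** * Dyadic summation of polynomial weights *)

Section dyadic.
Variable R : realType.
Implicit Types (r p e : R) (m d : nat).

Lemma half_le_ln2 : 2^-1 <= ln 2 :> R.
Proof.
have /le_ln1Dx : -1 < - 2^-1 :> R by lra.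
rewrite (_ : 1 + - 2^-1 = 2^-1 :> R); last by lra.
by rewrite lnV ?posrE// lerN2.
Qed.

(** The ratio q = 2^(-e) satisfies q (1 + e / 2) <= 1, because
    2^e >= 1 + e ln 2 >= 1 + e / 2; this makes 1 / (1 - q) of order 1 + 1 / e
    uniformly in e. *)
Lemma geometric_pow2N_le e N : 0 < e ->
  \sum_(m < N) ((2:R) `^ (- e)) ^+ m <= 2 * (1 + 1 / e).
Proof.
move=> e0; set q := 2 `^ (- e).
have q0 : 0 < q by rewrite powR_gt0.
have q1e : q * (1 + e / 2) <= 1.
  rewrite /q powRN mulrC ler_pdivrMr ?powR_gt0// mul1r.
  rewrite /powR ifF; last by apply/negbTE.
  apply: le_trans (expR_ge1Dx _); rewrite lerD2l ler_wpM2l ?half_le_ln2//.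
  exact: ltW.
have q1 : q < 1 by nra.
have S0 : 0 < 1 - q by rewrite subr_gt0.
have -> : \sum_(m < N) q ^+ m = (1 - q ^+ N) / (1 - q).
  apply: (mulIf (lt0r_neq0 S0)); rewrite divfK ?gt_eqF//.
  by have := subrX1 q N; lra.
rewrite ler_pdivrMr//.
have q_N : 0 <= q ^+ N by rewrite exprn_ge0// ltW.
apply: (@le_trans _ _ 1); first by lra.
have e1 : 1 / e * e = 1 by rewrite divfK ?gt_eqF.
have ie0 : 0 < 1 / e by rewrite divr_gt0.
set ie := 1 / e in e1 ie0 *; nra.
Qed.

Definition dyadic_weight p m : R := ((2:R) ^+ m) `^ (- p).

Lemma dyadic_weight_ge0 p m : 0 <= dyadic_weight p m.
Proof. exact: powR_ge0. Qed.

Lemma dyadic_shell r : 0 <= r -> exists m : nat, 2 ^+ m <= 1 + r < 2 ^+ m.+1.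
Proof.
move=> r0; have r1 : 0 <= 1 + r by lra.
have /andP[nr rn] := truncn_itv r1; set n := Num.truncn (1 + r) in nr rn.
have n0 : (0 < n)%N.
  by rewrite lt0n; apply/negP => /eqP n0; move: rn; rewrite n0; lra.
have /andP[mn nm] := trunc_log_bounds (isT : (1 < 2)%N) n0.
exists (trunc_log 2 n); rewrite -!natrX; apply/andP; split.
  by rewrite (le_trans _ nr)// ler_nat.
by rewrite (lt_le_trans rn)// ler_nat.
Qed.

(** The term of index m, where 2^m <= 1 + r < 2^(m+1), already dominates the
    left-hand side. *)
Lemma powRN_le_dyadic_series p r : 0 <= p -> 0 <= r ->
  (((1 + r) `^ (- p))%:E <=
   \sum_(m <oo) (dyadic_weight p m * (r < 2 ^+ m.+1)%R%:R)%:E)%E.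
Proof.
move=> p0 r0; have [m /andP[mr rm]] := dyadic_shell r0.
apply: le_trans (@nneseries_lim_ge _ _ xpredT 0 m.+1 _); last first.
  by move=> n _ _; rewrite lee_fin mulr_ge0 ?dyadic_weight_ge0.
rewrite big_nat_recr//= [X in (_ <= _ + X)%E](_ : _ = (dyadic_weight p m)%:E); last first.
  by rewrite (_ : (r < 2 ^+ m.+1) = true) ?mulr1//; apply: lt_trans rm; lra.
apply: (@le_trans _ _ (dyadic_weight p m)%:E).
  rewrite lee_fin /dyadic_weight !powRN lef_pV2 ?posrE ?powR_gt0 ?exprn_gt0//.
    by rewrite ge0_ler_powR// ?nnegrE ?exprn_ge0//; lra.
  lra.
rewrite leeDr// sumEFin lee_fin sumr_ge0// => n _.
by rewrite mulr_ge0 ?dyadic_weight_ge0.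
Qed.

Definition shell_const d : R := 2 * 4 ^+ d.

(** The balls of radius 2^(m+1) have volume of order 2^(m d), both for
    Lebesgue measure and for counting lattice points, so that the m-th shell
    contributes at most a multiple of 2^(- m e). *)
Lemma dyadic_volume_series d p e : 0 < e -> d%:R + e <= p ->
  (\sum_(m <oo) (dyadic_weight p m * (2 * 2 ^+ m.+1) ^+ d)%:E
     <= (shell_const d * (1 + 1 / e))%:E)%E.
Proof.
move=> e0 dp; have ge0 m : 0 <= dyadic_weight p m * (2 * 2 ^+ m.+1) ^+ d.
  by rewrite mulr_ge0 ?dyadic_weight_ge0// exprn_ge0// mulr_ge0// exprn_ge0.
apply: lime_le; first by apply: is_cvg_nneseries => m _ _; rewrite lee_fin.
apply: nearW => N; rewrite sumEFin lee_fin big_mkord.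
rewrite /shell_const -mulrA mulrCA.
apply: le_trans (ler_wpM2l _ (geometric_pow2N_le N e0)); last by rewrite exprn_ge0.
rewrite mulr_sumr; apply: ler_sum => m _.
rewrite exprS mulrA exprMn (_ : 2 * 2 = 4 :> R); last by ring.
rewrite mulrCA ler_wpM2l ?exprn_ge0// /dyadic_weight.
rewrite -!powR_mulrn// ?powR_ge0// -!powRrM -powRD; last by rewrite pnatr_eq0 implybT.
apply: ler_powR; first by rewrite ler1n.
have := ler0n R m; nra.
Qed.

End dyadic.

Section lattice_distance.
Variables (R : realType) (d : nat).
Implicit Types (y : 'I_d -> R) (k : lattice d).

Definition supdist y k : R := \big[Num.max/0]_(i < d) `|y i - (k i)%:~R|.

Lemma supdist_ge0 y k : 0 <= supdist y k.
Proof. by have /bigmax_leP[] := lexx (supdist y k). Qed.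

Lemma le_supdist y k i : `|y i - (k i)%:~R| <= supdist y k.
Proof. exact: (le_bigmax 0 (fun i => `|y i - (k i)%:~R|)). Qed.

(** Each coordinate of a lattice point in the open cube of half-side n is one
    of the 2 n integers following the floor of y_l - n. *)
Lemma card_supdist_lt (I : finType) (pos : I -> lattice d) y n :
  injective pos -> (0 < n)%N ->
  (#|[set i | (supdist y (pos i) < n%:R)%R]%SET| <= (2 * n) ^ d)%N.
Proof.
move=> posI n0; have n20 : (0 < 2 * n)%N by rewrite muln_gt0.
pose lo l : int := Num.floor (y l - n%:R).
pose h i : {ffun 'I_d -> 'I_(2 * n).-1.+1} :=
  [ffun l => inord (absz (pos i l - lo l - 1)%R)].
set S := finset _.
have hS i l : i \in S -> (h i l : nat)%:Z = pos i l - lo l - 1.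
  rewrite inE => /bigmax_ltP[_ /(_ l isT)]; rewrite ltr_norml => /andP[yl1 yl2].
  have /andP[lo1 lo2] := floor_itv (y l - n%:R); rewrite -/(lo l) in lo1 lo2.
  have lo_pos : lo l < pos i l by rewrite -(ltr_int R); lra.
  have pos_lo : pos i l < lo l + 1 + (2 * n)%:Z.
    by rewrite -(ltr_int R) !intrD -pmulrn natrM; rewrite intrD in lo2; lra.
  have abs : (absz (pos i l - lo l - 1)%R)%:Z = pos i l - lo l - 1.
    by rewrite gez0_abs//; lia.
  by rewrite ffunE inordK// prednK//; lia.
have hI : {in S &, injective h}.
  move=> i j iS jS hij; apply: posI; apply/ffunP => l.
  by have := hS i l iS; rewrite hij hS//; lia.
rewrite -(card_in_imset hI); apply: leq_trans (max_card _) _.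
by rewrite card_ffun !card_ord prednK.
Qed.

Lemma sum_powRN_supdist_le (I : finType) (pos : I -> lattice d) y (p e : R) :
  injective pos -> 0 < e -> d%:R + e <= p ->
  \sum_i (1 + supdist y (pos i)) `^ (- p) <= shell_const R d * (1 + 1 / e).
Proof.
move=> posI e0 dp; have p0 : 0 <= p by apply: le_trans dp; have := ler0n R d; lra.
rewrite -lee_fin -sumEFin; apply: le_trans (dyadic_volume_series e0 dp).
apply: (@le_trans _ _ (\sum_i \sum_(m <oo)
   (dyadic_weight p m * (supdist y (pos i) < 2 ^+ m.+1)%R%:R)%:E)%E).
  by apply: lee_sum => i _; apply: powRN_le_dyadic_series => //; exact: supdist_ge0.
rewrite -nneseries_sum; last first.
  by move=> i m _; rewrite lee_fin mulr_ge0 ?dyadic_weight_ge0.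
apply: lee_nneseries => [m _ _|m _].
  by apply: sume_ge0 => i _; rewrite lee_fin mulr_ge0 ?dyadic_weight_ge0.
rewrite sumEFin lee_fin -mulr_sumr ler_wpM2l ?dyadic_weight_ge0//.
have := @card_supdist_lt I pos y (2 ^ m.+1) posI (expn_gt0 _ _).
rewrite -(ler_nat R) !(natrX, natrM); apply: le_trans.
by rewrite -natr_sum ler_nat -sum1_card [leqRHS]big_mkcond/=;
  apply: leq_sum => i _; rewrite inE; case: ifP.
Qed.

End lattice_distance.

Section measurable_max.
Context disp (T : measurableType disp) (R : realType).

Lemma measurable_bigmaxr (I : Type) (l : seq I) (F : I -> T -> R) :
  (forall i, measurable_fun setT (F i)) ->
  measurable_fun setT (fun x => \big[Num.max/0]_(i <- l) F i x).
Proof.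
move=> mF; elim: l => [|i l IH].
  by under eq_fun do rewrite big_nil; exact: measurable_cst.
by under eq_fun do rewrite big_cons; exact: measurable_maxr.
Qed.

Lemma measurable_abs_sub (f : T -> R) (c : R) :
  measurable_fun setT f -> measurable_fun setT (fun x => `|f x - c|).
Proof.
by move=> mf; apply: measurableT_comp => //; exact: measurable_funB.
Qed.

Lemma measurable_powRN_1D (f : T -> R) (p : R) :
  measurable_fun setT f -> measurable_fun setT (fun x => (1 + f x) `^ (- p)).
Proof.
move=> mf; apply: (measurableT_comp (measurable_powR _)).
exact: measurable_funD.
Qed.

Lemma measurable_decay_bound (f : T -> R) (D : R) t :
  measurable_fun setT f -> (forall x, 0 <= f x) ->
  measurable_fun setT (fun x => D * (1 + f x) ^- t).
Proof.
move=> mf f0; under eq_fun do rewrite -powR_invn ?addr_ge0//.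
by apply: measurable_funM => //; exact: measurable_powRN_1D.
Qed.

(** The only information on mu and r is the growth of the measure of the
    sublevel sets of r, at most that of Euclidean cubes. *)
Lemma integral_powRN_le (mu : {measure set T -> \bar R}) (r : T -> R) d (p e : R) :
  measurable_fun setT r -> (forall x, 0 <= r x) ->
  (forall c, 0 < c -> (mu [set x | r x < c]%R <= ((2 * c) ^+ d)%:E)%E) ->
  0 < e -> d%:R + e <= p ->
  (\int[mu]_x ((1 + r x) `^ (- p))%:E <= (shell_const R d * (1 + 1 / e))%:E)%E.
Proof.
move=> mr r0 mu_r e0 dp.
have p0 : 0 <= p by apply: le_trans dp; have := ler0n R d; lra.
have mdist m : measurable [set x | r x < 2 ^+ m].
  rewrite (_ : mkset _ = setT `&` r @^-1` [set` `]-oo, (2 ^+ m)[%R]); last first.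
    by rewrite setTI; apply/seteqP; split=> x /=; rewrite in_itv.
  by apply: mr => //; exact: measurable_itv.
have mterm m : measurable_fun setT
    (fun x => (dyadic_weight p m * \1_[set x | r x < 2 ^+ m.+1] x)%:E).
  by apply/measurable_EFinP; apply: measurable_funM => //; exact: measurable_indic.
apply: le_trans (dyadic_volume_series e0 dp).
apply: (@le_trans _ _ (\int[mu]_x \sum_(m <oo)
    (dyadic_weight p m * \1_[set x | r x < 2 ^+ m.+1] x)%:E)%E).
  apply: ge0_le_integral => //.
  - by move=> x _; rewrite lee_fin powR_ge0.
  - by apply/measurable_EFinP; exact: measurable_powRN_1D.
  - apply: ge0_emeasurable_sum => [m x _ _|m _].
      by rewrite lee_fin mulr_ge0 ?dyadic_weight_ge0.
    exact: mterm.
  - move=> x _; apply: le_trans (powRN_le_dyadic_series p0 (r0 x)) _.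
    apply: lee_nneseries => [m _ _|m _].
      by rewrite lee_fin mulr_ge0 ?dyadic_weight_ge0.
    by rewrite indicE mem_setE.
rewrite integral_nneseries//; last first.
  by move=> m x _; rewrite lee_fin mulr_ge0 ?dyadic_weight_ge0.
apply: lee_nneseries => [m _ _|m _].
  by apply: integral_ge0 => x _; rewrite lee_fin mulr_ge0 ?dyadic_weight_ge0.
under eq_integral do rewrite EFinM.
rewrite ge0_integralZl//; last 2 first.
- by apply/measurable_EFinP; exact: measurable_indic.
- by rewrite lee_fin dyadic_weight_ge0.
rewrite integral_indic// setIT EFinM lee_wpmul2l ?lee_fin ?dyadic_weight_ge0//.
by rewrite mu_r ?exprn_gt0.
Qed.

End measurable_max.

Section lebesgue_distance.
Variables (R : realType) (d : nat).
Implicit Types (x : euclidean R d) (k : lattice d).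

Lemma max_dist_ge0 x k : 0 <= max_dist x k.
Proof. exact: supdist_ge0. Qed.

Lemma max_dist_box (k : lattice d) (r : R) : 0 < r ->
  [set x : euclidean R d | max_dist x k < r] =
  [set x : euclidean R d | forall i, [set` `](k i)%:~R - r, (k i)%:~R + r[] (tnth x i)].
Proof.
move=> r0; apply/seteqP; split=> x /=.
  move=> /bigmax_ltP[_ xk] i; have := xk i isT.
  by rewrite in_itv/= ltr_norml => /andP[? ?]; apply/andP; split; lra.
move=> xk; apply/bigmax_ltP; split=> // i _; have := xk i.
by rewrite in_itv/= ltr_norml => /andP[? ?]; apply/andP; split; lra.
Qed.

Lemma measurable_euclidean_box (A : 'I_d -> set (measurableTypeR R)) :
  (forall i, measurable (A i)) ->
  measurable [set x : euclidean R d | forall i, A i (tnth x i)].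
Proof.
by move=> mA; apply: caratheodory_measurable_mu_ext; exact: measurable_tuple_box.
Qed.

Lemma measurable_tnth_euclidean i :
  measurable_fun setT (fun x : euclidean R d => tnth x i : measurableTypeR R).
Proof.
move=> _ A mA; rewrite setTI.
rewrite (_ : _ @^-1` _ = [set x : euclidean R d | forall j,
    (if j == i then A else setT) (tnth x j)]).
  apply: (@measurable_euclidean_box (fun j => if j == i then A else setT)) => j.
  by case: (j == i).
apply/seteqP; split=> x /= => [Ax j|/(_ i)]; last by rewrite eqxx.
by case: eqP => // ->.
Qed.

Lemma measurable_max_dist k :
  measurable_fun setT (fun x : euclidean R d => max_dist x k).
Proof.
apply: measurable_bigmaxr => i; apply: measurable_abs_sub.
exact: measurable_tnth_euclidean.
Qed.

Lemma lebesgue_max_dist_lt k (r : R) : 0 < r ->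
  lebesgue R d [set x | max_dist x k < r] = ((2 * r) ^+ d)%:E.
Proof.
move=> r0; rewrite max_dist_box//.
rewrite (@lebesgue_box _ _ (fun i => [set` `](k i)%:~R - r, (k i)%:~R + r[]))//.
rewrite (eq_bigr (fun=> (2 * r)%:E)) => [|i _]; last first.
  rewrite lebesgue_measure_itv/= lte_fin ifT; last by lra.
  by rewrite -EFinB; congr EFin; ring.
by rewrite prodEFin prodr_const card_ord.
Qed.

Lemma integral_powRN_max_dist_le k (p e : R) : 0 < e -> d%:R + e <= p ->
  (\int[lebesgue R d]_x ((1 + max_dist x k) `^ (- p))%:E <=
   (shell_const R d * (1 + 1 / e))%:E)%E.
Proof.
move=> e0 dp.
have box c : 0 < c ->
    (lebesgue R d [set x | max_dist x k < c]%R <= ((2 * c) ^+ d)%:E)%E.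
  by move=> c0; rewrite lebesgue_max_dist_lt.
exact: (@integral_powRN_le _ _ _ (lebesgue R d) (fun x => max_dist x k) d p e
  (measurable_max_dist k) (fun x => max_dist_ge0 x k) box e0 dp).
Qed.
End lebesgue_distance.

(** * Square-integrable complex functions as a real inner product space *)

Section complex_parts.
Variable R : rcfType.
Implicit Types z w : R[i].

Lemma ReM z w :
  complex.Re (z * w) = complex.Re z * complex.Re w - complex.Im z * complex.Im w.
Proof. by case: z; case: w. Qed.

Lemma ImM z w :
  complex.Im (z * w) = complex.Re z * complex.Im w + complex.Im z * complex.Re w.
Proof. by case: z; case: w. Qed.

Lemma ReD z w : complex.Re (z + w) = complex.Re z + complex.Re w.
Proof. by case: z; case: w. Qed.

Lemma ImD z w : complex.Im (z + w) = complex.Im z + complex.Im w.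
Proof. by case: z; case: w. Qed.

(** The real part of z times the conjugate of w. *)
Definition cdot z w : R :=
  complex.Re z * complex.Re w + complex.Im z * complex.Im w.

Lemma normc_ge0 z : 0 <= normc z.
Proof. by case: z => a b; exact: sqrtr_ge0. Qed.

Lemma sqr_normc_cdot z : normc z ^+ 2 = cdot z z.
Proof. by case: z => a b; rewrite sqr_sqrtr ?addr_ge0 ?sqr_ge0// /cdot/= !expr2. Qed.

Lemma cdot_le z w : `|cdot z w| <= normc z * normc w.
Proof.
case: z w => [a b] [c e].
rewrite -(ler_pXn2r (isT : (0 < 2)%N)) ?nnegrE ?mulr_ge0 ?normc_ge0//.
rewrite exprMn !sqr_normc_cdot real_normK ?num_real// /cdot/=.
have := sqr_ge0 (a * e - b * c); nra.
Qed.

Lemma normc_real (a : R) : normc a%:C%C = `|a|.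
Proof. by rewrite /normc/= expr0n addr0 sqrtr_sqr. Qed.

Lemma normc_sum (I : Type) (r : seq I) (F : I -> R[i]) :
  normc (\sum_(i <- r) F i) <= \sum_(i <- r) normc (F i).
Proof.
elim: r => [|i r IH]; first by rewrite !big_nil normc0.
by rewrite !big_cons; apply: le_trans (le_normcD _ _) _; rewrite lerD2l.
Qed.

End complex_parts.

Section real_square_integrable.
Context disp (T : measurableType disp) (R : realType).
Variable mu : {measure set T -> \bar R}.
Implicit Types a b : T -> R.

Definition sqint a :=
  measurable_fun setT a /\ mu.-integrable setT (EFin \o (fun x => a x ^+ 2)).

Lemma integrable_le a b : measurable_fun setT a -> (forall x, `|a x| <= b x) ->
  mu.-integrable setT (EFin \o b) -> mu.-integrable setT (EFin \o a).
Proof.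
move=> ma ab; apply: le_integrable => //; first exact/measurable_EFinP.
by move=> x _ /=; rewrite lee_fin (le_trans (ab x))// ler_norm.
Qed.

Lemma integrable_addR a b : mu.-integrable setT (EFin \o a) ->
  mu.-integrable setT (EFin \o b) -> mu.-integrable setT (EFin \o (fun x => a x + b x)).
Proof. by move=> ia ib; exact: (integrableD measurableT ia ib). Qed.

Lemma integrable_scaleR (c : R) a : mu.-integrable setT (EFin \o a) ->
  mu.-integrable setT (EFin \o (fun x => c * a x)).
Proof. by move=> ia; exact: (integrableZl measurableT c ia). Qed.

Lemma sqint_mul a b : sqint a -> sqint b ->
  mu.-integrable setT (EFin \o (fun x => a x * b x)).
Proof.
move=> [ma ia] [mb ib]; apply: (integrable_le _ _ (integrable_addR ia ib)).
  exact: measurable_funM.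
move=> x; rewrite ler_norml; apply/andP; split.
  have := sqr_ge0 (a x + b x); have := sqr_ge0 (a x); have := sqr_ge0 (b x); nra.
have := sqr_ge0 (a x - b x); have := sqr_ge0 (a x); have := sqr_ge0 (b x); nra.
Qed.

Lemma sqint_add a b : sqint a -> sqint b -> sqint (fun x => a x + b x).
Proof.
move=> [ma ia] [mb ib]; split; first exact: measurable_funD.
apply: (integrable_le _ _ (integrable_scaleR 2 (integrable_addR ia ib))).
  by apply: measurable_funX; exact: measurable_funD.
by move=> x; rewrite ger0_norm ?sqr_ge0//; have := sqr_ge0 (a x - b x); nra.
Qed.

Lemma sqint_scale (c : R) a : sqint a -> sqint (fun x => c * a x).
Proof.
move=> [ma ia]; split; first exact: measurable_funM.
apply: (integrable_le _ _ (integrable_scaleR (c ^+ 2) ia)).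
  by apply: measurable_funX; exact: measurable_funM.
by move=> x; rewrite ger0_norm ?sqr_ge0// exprMn.
Qed.

Lemma integral_sqr_small_ae0 a : measurable_fun setT a ->
  (forall e : R, 0 < e -> (\int[mu]_x (a x ^+ 2)%:E <= e%:E)%E) ->
  {ae mu, forall x, a x = 0}.
Proof.
move=> ma small.
have int0 : (\int[mu]_x `|(a x ^+ 2)%:E| = 0)%E.
  under eq_integral do rewrite gee0_abs ?lee_fin ?sqr_ge0//.
  apply/eqP; rewrite eq_le integral_ge0 ?andbT//; last first.
    by move=> x _; rewrite lee_fin sqr_ge0.
  by apply/lee_addgt0Pr => e e0; rewrite add0e; exact: small.
have := (ae_eq_integral_abs mu measurableT _).1 int0.
move=> /(_ _)[|N [mN N0 subN]].
  by apply/measurable_EFinP; exact: measurable_funX.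
exists N; split=> //; apply: subset_trans subN => x /= nax ax; apply: nax.
by have [] := ax I => /eqP; rewrite sqrf_eq0 => /eqP.
Qed.

End real_square_integrable.

Section complex_square_integrable.
Context disp (T : measurableType disp) (R : realType).
Variable mu : {measure set T -> \bar R}.
Implicit Types u v w : T -> R[i].

Definition csqint u :=
  sqint mu (fun x => complex.Re (u x)) /\ sqint mu (fun x => complex.Im (u x)).

(** The real part of the L^2 inner product. *)
Definition ip u v : R := \int[mu]_x cdot (u x) (v x).

Lemma csqint_add u v : csqint u -> csqint v -> csqint (fun x => u x + v x).
Proof.
move=> [ru iu] [rv iv]; split.
  under eq_fun do rewrite ReD; exact: sqint_add.
under eq_fun do rewrite ImD; exact: sqint_add.
Qed.

Lemma csqint_scale (c : R[i]) u : csqint u -> csqint (fun x => c * u x).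
Proof.
move=> [ru iu]; split.
  under eq_fun do rewrite ReM -mulNr.
  by apply: sqint_add; exact: sqint_scale.
under eq_fun do rewrite ImM.
by apply: sqint_add; exact: sqint_scale.
Qed.

Lemma csqint_sub u v : csqint u -> csqint v -> csqint (fun x => u x - v x).
Proof.
move=> Lu Lv; under eq_fun do rewrite -mulN1r.
by apply: csqint_add => //; exact: csqint_scale.
Qed.

Lemma csqint_integrable u v : csqint u -> csqint v ->
  mu.-integrable setT (EFin \o (fun x => cdot (u x) (v x))).
Proof.
by move=> [ru iu] [rv iv]; apply: integrable_addR; exact: sqint_mul.
Qed.

Lemma ipC u v : ip u v = ip v u.
Proof. by apply: eq_Rintegral => x _; rewrite /cdot mulrC [X in _ + X]mulrC. Qed.

Lemma ipDl u v w : csqint u -> csqint v -> csqint w ->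
  ip (fun x => u x + v x) w = ip u w + ip v w.
Proof.
move=> Lu Lv Lw; rewrite -RintegralD//; try exact: csqint_integrable.
by apply: eq_Rintegral => x _; rewrite /cdot ReD ImD; ring.
Qed.

Lemma ipZl (c : R) u w : csqint u -> csqint w ->
  ip (fun x => c%:C%C * u x) w = c * ip u w.
Proof.
move=> Lu Lw; rewrite -RintegralZl//; last exact: csqint_integrable.
by apply: eq_Rintegral => x _; rewrite /cdot ReM ImM/=; ring.
Qed.

Lemma ip_ge0 u : 0 <= ip u u.
Proof. by apply: Rintegral_ge0 => x _; rewrite -sqr_normc_cdot sqr_ge0. Qed.

Lemma ip_sqr_normc u : csqint u ->
  (\int[mu]_x (normc (u x) ^+ 2)%:E)%E = (ip u u)%:E.
Proof.
move=> Lu; under eq_integral do rewrite sqr_normc_cdot.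
by rewrite fineK//; exact: integrable_fin_num (csqint_integrable Lu Lu).
Qed.

Lemma ip_dominated u v (U V : T -> R) : csqint u -> csqint v ->
  measurable_fun setT U -> measurable_fun setT V ->
  (forall x, normc (u x) <= U x) -> (forall x, normc (v x) <= V x) ->
  (`|ip u v|%:E <= \int[mu]_x (U x * V x)%:E)%E.
Proof.
move=> Lu Lv mU mV uU vV; have iuv := csqint_integrable Lu Lv.
have le_UV x : `|cdot (u x) (v x)| <= U x * V x.
  by apply: le_trans (cdot_le _ _) _; rewrite ler_pM ?normc_ge0.
rewrite EFin_normr_Rintegral//; apply: le_trans (le_abse_integral mu measurableT _) _.
  by case/integrableP: iuv.
apply: ge0_le_integral => //.
- by apply: measurableT_comp => //; case/integrableP: iuv.
- by apply/measurable_EFinP; exact: measurable_funM.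
- by move=> x _ /=; rewrite lee_fin.
Qed.

Lemma measurable_normc u :
  measurable_fun setT (fun x => complex.Re (u x)) ->
  measurable_fun setT (fun x => complex.Im (u x)) ->
  measurable_fun setT (fun x => normc (u x)).
Proof.
move=> mr mi; rewrite (_ : (fun x => normc (u x)) = Num.sqrt \o
    (fun x => complex.Re (u x) ^+ 2 + complex.Im (u x) ^+ 2)); last first.
  by apply/funext => x /=; case: (u x).
apply: measurableT_comp.
  exact: (continuous_measurable_fun (@sqrt_continuous R)).
by apply: measurable_funD; exact: measurable_funX.
Qed.

Lemma ipDr u v w : csqint u -> csqint v -> csqint w ->
  ip w (fun x => u x + v x) = ip w u + ip w v.
Proof. by move=> *; rewrite ipC ipDl// 2!(ipC w). Qed.

Lemma ip_sqrD u v : csqint u -> csqint v ->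
  ip (fun x => u x + v x) (fun x => u x + v x) = ip u u + 2 * ip u v + ip v v.
Proof.
move=> Lu Lv; rewrite ipDl// ?ipDr//; last exact: csqint_add.
by rewrite (ipC v u); ring.
Qed.

(** Since u + l v has nonnegative square norm for every real l, so that a
    quadratic polynomial in l without constant term is nonnegative, its linear
    coefficient vanishes. *)
Lemma ip_null u v : csqint u -> csqint v -> ip u u = 0 -> ip u v = 0.
Proof.
move=> Lu Lv u0; set b := ip u v; set a := ip v v.
have a0 : 0 <= a := ip_ge0 v.
(* The denominator a + 1 instead of the minimizer - b / a allows a = 0. *)
pose l : R := - b / (a + 1).
have Llv := csqint_scale l%:C%C Lv.
have := ip_ge0 (fun x => u x + l%:C%C * v x).
rewrite ip_sqrD// u0 add0r ipC ipZl// (ipC v u) -/b ipZl// ipC ipZl// -/a.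
have a1 : 0 < a + 1 by lra.
have la : l * (a + 1) = - b by rewrite divfK ?gt_eqF.
move=> pos; have : (a + 2) * l ^+ 2 <= 0 by nra.
rewrite pmulr_rle0; last by lra.
move=> l0; have {l0} : l ^+ 2 == 0 by rewrite eq_le l0 sqr_ge0.
by rewrite sqrf_eq0 => /eqP l0; move: la; rewrite l0; lra.
Qed.

Section combinations.
Variables (I : finType) (F : I -> T -> R[i]).
Hypothesis LF : forall p, csqint (F p).
Implicit Types c : I -> R.

Definition comb c : T -> R[i] := fun x => \sum_p (c p)%:C%C * F p x.

Lemma csqint0 : csqint (fun=> 0).
Proof.
by split; split=> //; rewrite (_ : EFin \o _ = cst 0%E) ?integrable0//;
  apply/funext => x /=; rewrite expr0n.
Qed.

Let csqint_sum c (r : seq I) : csqint (fun x => \sum_(p <- r) (c p)%:C%C * F p x).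
Proof.
elim: r => [|p r IH]; first by under eq_fun do rewrite big_nil; exact: csqint0.
under eq_fun do rewrite big_cons.
exact: csqint_add (csqint_scale _ (LF p)) IH.
Qed.

Lemma csqint_comb c : csqint (comb c).
Proof. exact: csqint_sum. Qed.

Lemma ip_combl c w : csqint w -> ip (comb c) w = \sum_p c p * ip (F p) w.
Proof.
move=> Lw; rewrite /comb; elim: (index_enum I) => [|p r IH].
  rewrite big_nil; under eq_fun do rewrite big_nil.
  rewrite /ip /Rintegral integral0_eq// => x _.
  by rewrite /cdot/= !mul0r addr0.
rewrite big_cons -IH -ipZl// -ipDl//; last exact: csqint_scale.
by congr (ip _ w); apply/funext => x; rewrite big_cons.
Qed.

Lemma ip_comb c : ip (comb c) (comb c) = \sum_p c p * \sum_q ip (F p) (F q) * c q.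
Proof.
rewrite ip_combl; last exact: csqint_comb.
apply: eq_bigr => p _; rewrite ipC ip_combl//; congr (_ * _).
by apply: eq_bigr => q _; rewrite mulrC ipC.
Qed.

(** The hypothesis is the system of normal equations: it makes the residual
    u - comb v orthogonal to all F p, and Pythagoras applies. *)
Lemma best_approximation u (v c : I -> R) : csqint u ->
  (forall p, \sum_q ip (F p) (F q) * v q = ip (F p) u) ->
  ip (fun x => u x - comb v x) (fun x => u x - comb v x) <=
  ip (fun x => u x - comb c x) (fun x => u x - comb c x).
Proof.
move=> Lu normal_eq; pose r x := u x - comb v x.
have LNcomb a : csqint (fun x => (-1)%:C%C * comb a x).
  exact: csqint_scale (csqint_comb a).
have rE : r = (fun x => u x + (-1)%:C%C * comb v x).
  by apply/funext => x; rewrite rmorphN1 mulN1r.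
have Lr : csqint r by rewrite rE; exact: csqint_add.
have orth p : ip (F p) r = 0.
  rewrite rE ipDr// [X in _ + X]ipC (@ipZl _ (comb v))//; last exact: csqint_comb.
  rewrite ip_combl// -normal_eq.
  by under [X in _ + _ * X]eq_bigr do rewrite mulrC ipC; lra.
pose k := comb (fun p => v p - c p).
have -> : (fun x => u x - comb c x) = (fun x => r x + k x).
  apply/funext => x; rewrite /r /k /comb -addrA; congr (_ + _).
  rewrite -sumrN -sumrN -big_split/=; apply: eq_bigr => p _.
  by rewrite rmorphB; ring.
have Lk : csqint k := csqint_comb _.
have rk : ip r k = 0.
  by rewrite ipC ip_combl// big1// => p _; rewrite orth mulr0.
by rewrite (ip_sqrD Lr Lk) rk mulr0 addr0 lerDl ip_ge0.
Qed.

End combinations.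
End complex_square_integrable.

(** * Finite sections of the Gram matrix *)

Section weights.
Variables (R : realType) (d : nat).
Implicit Types (y : 'I_d -> R) (k j : lattice d).

Lemma coord_dist_le y k j i :
  `|(k i)%:~R - (j i)%:~R| <= supdist y k + supdist y j.
Proof.
rewrite distrC (_ : _ - _ = (y i - (k i)%:~R) - (y i - (j i)%:~R)); last by ring.
by apply: le_trans (ler_normB _ _) _; rewrite lerD// le_supdist.
Qed.

Lemma supdist_attained y k : 0 < supdist y k ->
  exists i, supdist y k <= `|y i - (k i)%:~R|.
Proof.
move=> y0; apply: contrapT => /forallNP small.
have : supdist y k < supdist y k.
  by apply/bigmax_ltP; split=> // i _; rewrite ltNge; apply/negP; exact: small.
by rewrite ltxx.
Qed.

Lemma exp_add_le (a b : R) n : 0 <= a -> 0 <= b ->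
  (a + b) ^+ n <= 2 ^+ n * (a ^+ n + b ^+ n).
Proof.
move=> a0 b0; wlog ab : a b a0 b0 / a <= b.
  move=> H; have [/H|/ltW /H] := leP a b; first exact.
  by rewrite addrC [X in _ <= _ * X]addrC; exact.
apply: (@le_trans _ _ (2 ^+ n * b ^+ n)).
  by rewrite -exprMn lerXn2r ?nnegrE ?addr_ge0 ?mulr_ge0//; lra.
by rewrite ler_wpM2l ?exprn_ge0// lerDr exprn_ge0.
Qed.

Lemma powRN_mulX (a p : R) n : 0 < a -> a ^+ n * a `^ (- p) = a `^ (- (p - n%:R)).
Proof.
move=> a0; rewrite -powR_mulrn ?ltW// -powRD; last by apply/implyP => _; rewrite gt_eqF.
by congr (_ `^ _); ring.
Qed.

(** The weight |k_i - j_i|^a is charged to the larger of the two distances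
    only, so that in each term just one of the two factors loses decay. *)
Lemma coord_moment_le y k j i (s : R) a t : (a <= t)%N ->
  `|(k i)%:~R - (j i)%:~R| ^+ a *
     ((1 + supdist y k) `^ (- s) * (1 + supdist y j) `^ (- s)) <=
  2 ^+ t * ((1 + supdist y k) `^ (- (s - t%:R)) * (1 + supdist y j) `^ (- s) +
            (1 + supdist y k) `^ (- s) * (1 + supdist y j) `^ (- (s - t%:R))).
Proof.
move=> le_at; have := coord_dist_le y k j i.
have := supdist_ge0 y k; have := supdist_ge0 y j.
set rk := supdist y k; set rj := supdist y j => rj0 rk0 dist_le.
have X0 : 0 < 1 + rk by lra.
have Y0 : 0 < 1 + rj by lra.
rewrite -!powRN_mulX// (_ : _ * (_ * _ + _) =
  (2 ^+ t * ((1 + rk) ^+ t + (1 + rj) ^+ t)) *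
   ((1 + rk) `^ (- s) * (1 + rj) `^ (- s))); last by ring.
rewrite ler_wpM2r ?mulr_ge0 ?powR_ge0//.
apply: le_trans (exp_add_le t (ltW X0) (ltW Y0)).
apply: (@le_trans _ _ ((1 + rk + (1 + rj)) ^+ a)).
  by rewrite lerXn2r ?nnegrE//; lra.
by rewrite ler_weXn2l//; lra.
Qed.

(** One of 1 + |y - k| and 1 + |k - j| is at least half of 1 + |y - j|; the
    corresponding factor is traded for the decay in |y - j|, and the other
    one remains to be summed over k. *)
Lemma convolution_le y k j (s : R) t : t%:R <= s ->
  (1 + supdist y j) ^+ t *
    ((1 + supdist (fun i => (j i)%:~R) k) ^- t * (1 + supdist y k) `^ (- s)) <=
  2 ^+ t * ((1 + supdist y k) `^ (- s) + (1 + supdist (fun i => (j i)%:~R) k) ^- t).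
Proof.
move=> ts.
have tri : supdist y j <= supdist y k + supdist (fun i => (j i)%:~R) k.
  apply/bigmax_leP; split=> [|i _]; first by rewrite addr_ge0 ?supdist_ge0.
  rewrite (_ : _ - _ = (y i - (k i)%:~R) - ((j i)%:~R - (k i)%:~R)); last by ring.
  apply: le_trans (ler_normB _ _) _; rewrite lerD ?le_supdist//.
move: tri; have := supdist_ge0 y k; have := supdist_ge0 y j.
have := supdist_ge0 (fun i => (j i)%:~R : R) k.
set rk := supdist y k; set rj := supdist y j; set q := supdist _ k => q0 rj0 rk0 tri.
have X0 : 0 < 1 + rk by lra.
have Q0 : 0 < 1 + q by lra.
have Qt0 : 0 <= (1 + q) ^- t by rewrite invr_ge0 exprn_ge0// ltW.
apply: (@le_trans _ _ (2 ^+ t * ((1 + rk) ^+ t + (1 + q) ^+ t) *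
    ((1 + q) ^- t * (1 + rk) `^ (- s)))).
  rewrite ler_wpM2r ?mulr_ge0 ?powR_ge0//.
  apply: le_trans (exp_add_le t (ltW X0) (ltW Q0)).
  by rewrite lerXn2r ?nnegrE//; lra.
rewrite -mulrA ler_wpM2l ?exprn_ge0// mulrDl addrC lerD//.
  by rewrite mulrA divff ?mul1r// expf_neq0// gt_eqF.
rewrite mulrCA powRN_mulX// ler_piMr//.
by rewrite -[leRHS](powRr0 (1 + rk)) ler_powR//; lra.
Qed.

End weights.

Section finite_section.
Context disp (T : measurableType disp) (R : realType).
Variables (mu : {measure set T -> \bar R}) (d : nat) (y : T -> 'I_d -> R).
Local Notation K := (shell_const R d).
Hypothesis mdist : forall k, measurable_fun setT (fun x => supdist (y x) k).
Hypothesis int_dist : forall k (p e : R), 0 < e -> d%:R + e <= p ->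
  (\int[mu]_x ((1 + supdist (y x) k) `^ (- p))%:E <= (K * (1 + 1 / e))%:E)%E.

Variables (C s : R) (t : nat).
Hypothesis C1 : 1 <= C.
Hypothesis dt : (d < t)%N.
Hypothesis dts : d%:R + t%:R < s.
Let L : R := 1 + 1 / (s - t%:R - d%:R).

Let K0 : 0 < K.
Proof. by rewrite /shell_const mulr_gt0// exprn_gt0. Qed.

Let e0 : 0 < s - t%:R - d%:R.
Proof. by rewrite -addrA -opprD subr_gt0 addrC. Qed.

Let L1 : 1 <= L.
Proof. by rewrite /L lerDl divr_ge0// ltW. Qed.

Let dt1 : d%:R + 1 <= t%:R :> R.
Proof. by rewrite natr1 ler_nat. Qed.

Let ds1 : d%:R + 1 <= s.
Proof. by have := ler0n R d; move: dt1 dts; lra. Qed.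

Variables (I : finType) (pos : I -> lattice d).
Hypothesis posI : injective pos.

Lemma coord_moment_sum_le x (j : lattice d) i a : (a <= t)%N ->
  \sum_k `|(pos k i)%:~R - (j i)%:~R| ^+ a *
     ((1 + supdist (y x) (pos k)) `^ (- s) * (1 + supdist (y x) j) `^ (- s)) <=
  2 ^+ t * (K * L * (1 + supdist (y x) j) `^ (- s) +
            K * 2 * (1 + supdist (y x) j) `^ (- (s - t%:R))).
Proof.
move=> le_at; apply: le_trans (ler_sum _ (fun k _ => coord_moment_le _ _ _ _ _ le_at)) _.
rewrite -mulr_sumr ler_wpM2l ?exprn_ge0// big_split/= -!mulr_suml lerD//.
  rewrite ler_wpM2r ?powR_ge0//; apply: sum_powRN_supdist_le => //.
  by have := e0; lra.
rewrite ler_wpM2r ?powR_ge0// (_ : K * 2 = K * (1 + 1 / 1)); last by rewrite divr1.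
exact: sum_powRN_supdist_le.
Qed.

Variable f : I -> T -> R[i].
Hypothesis Lf : forall k, csqint mu (f k).
Hypothesis f_le : forall k x, normc (f k x) <= C * (1 + supdist (y x) (pos k)) `^ (- s).

(** The family f_k, i f_k spans over the reals what f_k spans over the
    complex numbers. *)
Definition real_frame (p : I * bool) : T -> R[i] :=
  if p.2 then fun x => 'i%C * f p.1 x else f p.1.

Lemma csqint_real_frame p : csqint mu (real_frame p).
Proof. by rewrite /real_frame; case: p.2 => //; exact: csqint_scale. Qed.

Lemma normc_real_frame p x : normc (real_frame p x) = normc (f p.1 x).
Proof.
rewrite /real_frame; case: p.2 => //.
by rewrite normcM /normc/= expr0n expr1n add0r sqrtr1 mul1r.
Qed.

Definition gram p q := ip mu (real_frame p) (real_frame q).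

Definition schur_const : R := 8 * K ^+ 2 * 2 ^+ t * C ^+ 2 * L.

Let w k x : R := C * (1 + supdist (y x) (pos k)) `^ (- s).

Let mw k : measurable_fun setT (w k).
Proof. by apply: measurable_funM => //; exact: measurable_powRN_1D. Qed.

Lemma gram_le p q :
  (`|gram p q|%:E <= \int[mu]_x (w p.1 x * w q.1 x)%:E)%E.
Proof.
apply: ip_dominated; rewrite ?mw//; try exact: csqint_real_frame;
  by move=> x; rewrite normc_real_frame f_le.
Qed.

(** Bound the entries of the Gram matrix by integrals of products of weights,
    sum over q under the integral with [coord_moment_sum_le], then integrate
    over x. The 8 collects a factor 2 for the two copies of each index, 2 for
    the two terms of [coord_moment_le], and 2 for 1 + 1 / 1, the bound on the
    sum or integral whose exponent is at least d + 1. *)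
Lemma gram_moment i a p : (a <= t)%N ->
  \sum_q `|(pos p.1 i)%:~R - (pos q.1 i)%:~R| ^+ a * `|gram p q| <= schur_const.
Proof.
move=> le_at; rewrite -lee_fin -sumEFin.
pose W x j := (1 + supdist (y x) j) `^ (- s).
pose V x := K * L * W x (pos p.1) +
            K * 2 * (1 + supdist (y x) (pos p.1)) `^ (- (s - t%:R)).
have w0 k x : 0 <= w k x by rewrite mulr_ge0 ?powR_ge0//; have := C1; lra.
have mX k (e : R) : measurable_fun setT (fun x => (1 + supdist (y x) k) `^ (- e)).
  exact: measurable_powRN_1D.
apply: (@le_trans _ _ (\sum_q \int[mu]_x
   (`|(pos p.1 i)%:~R - (pos q.1 i)%:~R| ^+ a * (w p.1 x * w q.1 x))%:E)%E).
  apply: lee_sum => q _; under eq_integral do rewrite EFinM.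
  rewrite ge0_integralZl//.
  - by rewrite EFinM lee_wpmul2l ?gram_le// lee_fin exprn_ge0.
  - by apply/measurable_EFinP; exact: measurable_funM.
  - by move=> x _; rewrite lee_fin mulr_ge0.
rewrite -ge0_integral_sum//; last 2 first.
- move=> q; apply/measurable_EFinP; apply: measurable_funM => //.
  exact: measurable_funM.
- by move=> q x _; rewrite lee_fin mulr_ge0 ?exprn_ge0// mulr_ge0.
have le_V x : \sum_(q : I * bool)
    `|(pos p.1 i)%:~R - (pos q.1 i)%:~R| ^+ a * (w p.1 x * w q.1 x) <=
    (2 * C ^+ 2 * 2 ^+ t) * V x.
  rewrite -(pair_bigA _ (fun k (_ : bool) =>
    `|(pos p.1 i)%:~R - (pos k i)%:~R| ^+ a * (w p.1 x * w k x)))/=.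
  under eq_bigr do rewrite big_bool/=.
  rewrite big_split/= (_ : _ * V x = 2 * (C ^+ 2 * (2 ^+ t * V x))); last by ring.
  set S := \sum_(k : I) _.
  rewrite (_ : S + S = 2 * S) ?ler_wpM2l//; last by ring.
  have := ler_wpM2l (sqr_ge0 C) (coord_moment_sum_le x (pos p.1) i le_at).
  apply: le_trans; rewrite mulr_sumr; apply: ler_sum => k _.
  by rewrite distrC /w; lra.
have mV : measurable_fun setT V.
  by apply: measurable_funD; apply: measurable_funM => //; exact: mX.
apply: (@le_trans _ _ (\int[mu]_x ((2 * C ^+ 2 * 2 ^+ t) * V x)%:E)%E).
  apply: ge0_le_integral => //.
  - by move=> x _; apply: sume_ge0 => q _; rewrite lee_fin mulr_ge0 ?exprn_ge0// mulr_ge0.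
  - apply: emeasurable_sum => q; apply/measurable_EFinP; apply: measurable_funM => //.
    exact: measurable_funM.
  - by apply/measurable_EFinP; exact: measurable_funM.
  - by move=> x _; rewrite sumEFin lee_fin.
have KL0 : 0 <= K * L := mulr_ge0 (ltW K0) (le_trans ler01 L1).
have K20 : 0 <= K * 2 := mulr_ge0 (ltW K0) (ler0n R 2).
have V0 x : 0 <= V x.
  by apply: addr_ge0; apply: mulr_ge0 => //; exact: powR_ge0.
have c0 : 0 <= 2 * C ^+ 2 * 2 ^+ t.
  by rewrite mulr_ge0 ?exprn_ge0// mulr_ge0 ?sqr_ge0.
under eq_integral do rewrite EFinM.
rewrite ge0_integralZl//; last 2 first.
- exact/measurable_EFinP.
- by move=> x _; rewrite lee_fin.
rewrite /schur_const (_ : 8 * K ^+ 2 * 2 ^+ t * C ^+ 2 * L =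
  (2 * C ^+ 2 * 2 ^+ t) * (K * L * (K * (1 + 1 / 1)) + K * 2 * (K * L))); last by field.
rewrite [leRHS]EFinM lee_wpmul2l// EFinD.
have mEFin (c e : R) : measurable_fun setT
    (fun x => (c * (1 + supdist (y x) (pos p.1)) `^ (- e))%:E).
  by apply/measurable_EFinP; apply: measurable_funM => //; exact: mX.
have int_le (c e b : R) : 0 <= c -> 0 < b -> d%:R + b <= e ->
    (\int[mu]_x (c * (1 + supdist (y x) (pos p.1)) `^ (- e))%:E <=
     (c * (K * (1 + 1 / b)))%:E)%E.
  move=> c_ge0 b0 dbe; under eq_integral do rewrite EFinM.
  rewrite ge0_integralZl//.
  - by rewrite EFinM lee_wpmul2l ?lee_fin// int_dist.
  - by apply/measurable_EFinP; exact: mX.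
  - by move=> x _; rewrite lee_fin powR_ge0.
under eq_integral do rewrite /V EFinD.
rewrite ge0_integralD//; try exact: mEFin;
  try by move=> x _; rewrite lee_fin mulr_ge0 ?powR_ge0.
apply: leeD; first exact: int_le.
by apply: int_le => //; have := e0; lra.
Qed.

Definition complex_comb (c : I -> R[i]) : T -> R[i] := fun x => \sum_k c k * f k x.

Lemma comb_real_frame (a : I * bool -> R) :
  comb real_frame a = complex_comb (fun k => Complex (a (k, false)) (a (k, true))).
Proof.
apply/funext => x; rewrite /comb /complex_comb.
rewrite (eq_bigr (fun p : I * bool => (fun k b =>
  ((a (k, b))%:C)%C * real_frame (k, b) x) p.1 p.2)); last by case.
rewrite -(pair_bigA _ (fun k b => ((a (k, b))%:C)%C * real_frame (k, b) x))/=.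
apply: eq_bigr => k _; rewrite big_bool/= /real_frame/= addrC.
rewrite (complexE (Complex (a (k, false)) (a (k, true))))/=; ring.
Qed.

Lemma complex_comb_real (c : I -> R[i]) : complex_comb c =
  comb real_frame (fun p => if p.2 then complex.Im (c p.1) else complex.Re (c p.1)).
Proof.
rewrite comb_real_frame; congr complex_comb; apply/funext => k /=.
by case: (c k).
Qed.

Variable A : R.
Hypothesis A0 : 0 < A.
Hypothesis lower_frame : forall c : I -> R[i],
  A * \sum_k normc (c k) ^+ 2 <= ip mu (complex_comb c) (complex_comb c).

Lemma gram_coercive : coercive A gram.
Proof.
move=> a; have := lower_frame (fun k => Complex (a (k, false)) (a (k, true))).
rewrite -comb_real_frame ip_comb; last exact: csqint_real_frame.
apply: le_trans; rewrite sqr_l2norm ler_pM2l//.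
rewrite (eq_bigr (fun p : I * bool => (fun k b => a (k, b) ^+ 2) p.1 p.2)); last by case.
rewrite -(pair_bigA _ (fun k b => a (k, b) ^+ 2)); apply: ler_sum => k _.
by rewrite big_bool sqr_normc_cdot /cdot/= -!expr2 addrC.
Qed.

Definition pointwise_const : R :=
  8 * K * 4 ^+ t * C * (2 ^+ (t ^ 2) * schur_const ^+ t / A ^+ t.+1).

(** The decay of the coefficients v in each coordinate gives decay in the
    max-norm, by choosing the coordinate where the distance is attained; the
    moment of order 0 handles distances at most 1. It remains to convolve
    this decay with the decay of the f_k. *)
Lemma finite_dual_bound (hd : (0 < d)%N) k0 (v : I * bool -> R) :
  (forall p, \sum_q gram p q * v q = (p == (k0, false))%:R) ->
  forall x, normc (comb real_frame v x) <=
    pointwise_const * (1 + supdist (y x) (pos k0)) ^- t.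
Proof.
move=> Gv x; set M := 2 ^+ (t ^ 2) * schur_const ^+ t / A ^+ t.+1.
have symG p q : gram p q = gram q p by exact: ipC.
pose q k := supdist (fun i => (pos k0 i)%:~R) (pos k) : R.
have entry i p : `|(pos p.1 i)%:~R - (pos k0 i)%:~R| ^+ t * `|v p| <= M.
  exact: (inverse_column_decay A0 gram_coercive symG
    (pos := fun p => (pos p.1 i)%:~R) (fun a p => @gram_moment i a p) Gv).
pose i0 := Ordinal hd.
have C0 : 0 < C by exact: lt_le_trans C1.
have A_schur : A <= schur_const.
  apply: (coercive_le_moment (pos := fun p : I * bool => (pos p.1 i0)%:~R)
    (k0, false) gram_coercive) => a p; exact: gram_moment.
have S0 : 0 < schur_const := lt_le_trans A0 A_schur.
have M0 : 0 <= M by rewrite divr_ge0 ?mulr_ge0 ?exprn_ge0// ltW.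
have entry0 p : `|v p| <= M.
  have mom0 a p' : (a <= 0)%N -> \sum_q0
      `|(pos p'.1 i0)%:~R - (pos q0.1 i0)%:~R| ^+ a * `|gram p' q0| <= schur_const.
    by move=> a0; apply: gram_moment; exact: leq_trans a0 _.
  have := inverse_column_decay (pos := fun p => (pos p.1 i0)%:~R)
    A0 gram_coercive symG mom0 Gv p.
  rewrite exp0n// !expr0 !mul1r expr1 => /le_trans; apply.
  rewrite /M exprSr invfM !mulrA -[leLHS]mul1r ler_wpM2r ?invr_ge0 ?(ltW A0)//.
  rewrite -mulrA -expr_div_n -[leLHS]mul1r ler_pM//.
    by rewrite -natrX ler1n expn_gt0.
  by rewrite exprn_ege1// ler_pdivlMr ?mul1r.
have q0 k : 0 <= q k by exact: supdist_ge0.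
have v_le p : `|v p| <= 2 ^+ t * M * (1 + q p.1) ^- t.
  have Q0 : 0 < (1 + q p.1) ^+ t by rewrite exprn_gt0//; have := q0 p.1; lra.
  rewrite ler_pdivlMr// mulrC.
  have [q1|q1] := leP (q p.1) 1.
    apply: ler_pM => //; first exact: ltW.
    by rewrite lerXn2r ?nnegrE//; have := q0 p.1; lra.
  have [i qi] : exists i, q p.1 <= `|(pos k0 i)%:~R - (pos p.1 i)%:~R|.
    by apply: supdist_attained; exact: lt_trans q1.
  apply: (@le_trans _ _ (2 ^+ t * (q p.1 ^+ t * `|v p|))).
    rewrite mulrA -exprMn ler_wpM2r// lerXn2r ?nnegrE//; have := q0 p.1; lra.
  rewrite ler_wpM2l ?exprn_ge0//; apply: le_trans (entry i p).
  by rewrite ler_wpM2r// lerXn2r ?nnegrE// distrC.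
have t_s : t%:R <= s by have := ler0n R d; move: dts; lra.
set r0 := supdist (y x) (pos k0).
have r00 : 0 < (1 + r0) ^+ t.
  by rewrite exprn_gt0//; have := supdist_ge0 (y x) (pos k0); rewrite -/r0; lra.
rewrite ler_pdivlMr// mulrC.
pose W k : R := (1 + supdist (y x) (pos k)) `^ (- s).
apply: (@le_trans _ _ (2 * (2 ^+ t * M * C) *
  \sum_k (1 + r0) ^+ t * ((1 + q k) ^- t * W k))).
  apply: le_trans (ler_wpM2l (ltW r00) (normc_sum _ _)) _.
  rewrite (_ : 2 * _ * _ = \sum_k \sum_(b : bool)
    (1 + r0) ^+ t * (2 ^+ t * M * (1 + q k) ^- t * (C * W k))); last first.
    rewrite mulr_sumr; apply: eq_bigr => k _; rewrite big_bool/=; ring.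
  rewrite mulr_sumr pair_bigA/=; apply: ler_sum => p _.
  rewrite ler_wpM2l ?(ltW r00)// normcM normc_real normc_real_frame.
  by apply: ler_pM => //; rewrite ?normc_ge0.
rewrite (_ : pointwise_const =
  2 * (2 ^+ t * M * C) * (2 ^+ t * (K * 2 + K * 2))); last first.
  rewrite /pointwise_const -/M (_ : 4 = 2 * 2 :> R); last by ring.
  rewrite exprMn; ring.
have c0 : 0 <= 2 * (2 ^+ t * M * C).
  apply: mulr_ge0 => //; apply: mulr_ge0 (ltW C0).
  by apply: mulr_ge0 => //; exact: exprn_ge0.
rewrite ler_wpM2l//.
apply: le_trans (ler_sum _ (fun k _ => convolution_le _ _ _ t_s)) _.
rewrite -mulr_sumr ler_wpM2l ?exprn_ge0// big_split/=.
have -> : K * 2 = K * (1 + 1 / 1) by rewrite divr1.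
rewrite lerD ?sum_powRN_supdist_le//.
apply: le_trans (sum_powRN_supdist_le (fun i => (pos k0 i)%:~R) posI ltr01 dt1).
apply: ler_sum => k _; rewrite powRN powR_mulrn//.
by have := q0 k; rewrite /q; lra.
Qed.

(** The projection of the dual function g onto the span of a finite
    subfamily: it solves the finite Gram system with a basis vector as
    right-hand side, hence obeys the uniform pointwise bound. *)
Lemma finite_section_approximation (hd : (0 < d)%N) k0 (g : T -> R[i]) :
  csqint mu g -> (forall k, ip mu g (f k) = (k == k0)%:R) ->
  (forall k, ip mu g (fun x => 'i%C * f k x) = 0) ->
  exists h, [/\ csqint mu h,
    forall x, normc (h x) <= pointwise_const * (1 + supdist (y x) (pos k0)) ^- t &
    forall c : I -> R[i], ip mu (fun x => g x - h x) (fun x => g x - h x) <=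
      ip mu (fun x => g x - complex_comb c x) (fun x => g x - complex_comb c x)].
Proof.
move=> Lg gf gif.
have [v Gv] := coercive_solve (fun p => (p == (k0, false))%:R) A0 gram_coercive.
exists (comb real_frame v); split.
- exact: csqint_comb csqint_real_frame _.
- exact: finite_dual_bound.
- move=> c; rewrite complex_comb_real; apply: best_approximation => //.
    exact: csqint_real_frame.
  move=> p; rewrite Gv ipC; case: p => k [] /=.
    by rewrite gif xpair_eqE andbF.
  by rewrite gf xpair_eqE eqxx andbT.
Qed.

End finite_section.

(** * The explicit constant *)

(** With t <= t^2, all numerical factors are absorbed in the power t^2 of
    1024 K^3 = 8 K * 4 * (8 K^2) * (2 * 2). *)
Lemma pointwise_const_le (R : realType) d (C s A : R) t :
  1 <= C -> 0 < A -> (d < t)%N -> d%:R + t%:R < s ->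
  pointwise_const d C s t A <=
  (1024 * shell_const R d ^+ 3) ^+ (t ^ 2) * C ^+ (2 * t + 1) / A ^+ (t + 1)
    * (1 + 1 / (s - t%:R - d%:R)) ^+ t.
Proof.
move=> C1 A0 dt dts; rewrite /pointwise_const /schur_const.
set K := shell_const R d; set L := 1 + _.
have L0 : 0 <= L by rewrite addr_ge0// divr_ge0//; move: dts; lra.
have C0 : 0 <= C by lra.
have K1 : 1 <= K.
  have : 1 <= (4:R) ^+ d by rewrite exprn_ege1//; lra.
  by rewrite /K /shell_const; lra.
clearbody K.
have t0 : (0 < t)%N by rewrite (leq_ltn_trans _ dt).
have t2 : (0 < t ^ 2)%N by rewrite expn_gt0 t0.
have t_t2 : (t <= t ^ 2)%N by rewrite -{1}(expn1 t) leq_pexp2l.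
pose B := C ^+ (2 * t + 1) / A ^+ (t + 1) * L ^+ t.
have B0 : 0 <= B by rewrite !mulr_ge0 ?exprn_ge0 ?invr_ge0 ?exprn_ge0// ltW.
rewrite (_ : 8 * K * 4 ^+ t * C * _ =
  ((8 * K) ^+ 1 * 4 ^+ t * (8 * K ^+ 2) ^+ t * (2 * 2) ^+ (t ^ 2)) * B); last first.
  have eC : C ^+ (2 * t + 1) = (C ^+ 2) ^+ t * C by rewrite addn1 exprSr exprM.
  have e2 : (2:R) ^+ (t ^ 2) = (2 ^+ t) ^+ t by rewrite -exprM mulnn.
  rewrite /B eC addn1 !exprMn e2 !expr1.
  move: ((2 ^+ t) ^+ t) ((C ^+ 2) ^+ t) ((K ^+ 2) ^+ t) (4 ^+ t) (8 ^+ t)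
    (L ^+ t) (A ^- t.+1).
  by move=> *; ring.
rewrite [leRHS](_ : _ = (1024 * K ^+ 3) ^+ (t ^ 2) * B); last by rewrite /B; ring.
rewrite ler_wpM2r// (_ : 1024 * K ^+ 3 = 8 * K * 4 * (8 * K ^+ 2) * (2 * 2)); last by ring.
have K2 : 1 <= K ^+ 2 by rewrite exprn_ege1.
have pow_le (a : R) m : 1 <= a -> (m <= t ^ 2)%N -> 0 <= a ^+ m /\ a ^+ m <= a ^+ (t ^ 2).
  by move=> a1 mt; split; [rewrite exprn_ge0//; lra|rewrite ler_weXn2l].
have [? ?] := pow_le (8 * K) 1%N ltac:(lra) t2.
have [? ?] := pow_le 4 t ltac:(lra) t_t2.
have [? ?] := pow_le (8 * K ^+ 2) t ltac:(lra) t_t2.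
rewrite [leRHS]exprMn ler_wpM2r ?exprn_ge0//.
rewrite [leRHS]exprMn [X in _ <= X * _]exprMn.
by apply: ler_pM => //; [exact: mulr_ge0|exact: ler_pM].
Qed.

Section lnorm.
Context disp (T : measurableType disp) (R : realType).
Variable mu : {measure set T -> \bar R}.
Implicit Types u v : T -> R[i].

Let N2 u := Lnorm mu 2%:E (fun x => (normc (u x))%:E).

Lemma Lnorm2_sqr u : (N2 u ^+ 2 = \int[mu]_x (normc (u x) ^+ 2)%:E)%E.
Proof.
rewrite /N2 -[LHS]/(_ * _)%E.
have /esym := @poweR_Lnorm _ _ _ mu (fun x => (normc (u x))%:E) 2 ltac:(by []).
under eq_integral do
  rewrite gee0_abs ?lee_fin ?normc_ge0// poweR_EFin powR_mulrn ?normc_ge0//.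
move=> ->; have := Lnorm_ge0 mu 2%:E (fun x => (normc (u x))%:E).
case: (Lnorm _ _ _) => [r r0| |//]; last by rewrite poweRyr// mulyy.
by rewrite poweR_EFin powR_mulrn.
Qed.

Lemma Lnorm2_csqint u :
  measurable_fun setT (fun x => complex.Re (u x)) ->
  measurable_fun setT (fun x => complex.Im (u x)) ->
  (N2 u < +oo)%E -> csqint mu u.
Proof.
move=> mr mi uoo; have mn := measurable_normc mr mi.
have int_n : mu.-integrable setT (EFin \o (fun x => normc (u x) ^+ 2)).
  apply/integrableP; split; first by apply/measurable_EFinP; exact: measurable_funX.
  under eq_integral do rewrite /= ger0_norm ?sqr_ge0//.
  rewrite -Lnorm2_sqr; have := Lnorm_ge0 mu 2%:E (fun x => (normc (u x))%:E).
  by move: uoo; rewrite /N2; case: (Lnorm _ _ _) => [r _ _| |]//; rewrite ltry.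
have le_n x : complex.Re (u x) ^+ 2 <= normc (u x) ^+ 2 /\
              complex.Im (u x) ^+ 2 <= normc (u x) ^+ 2.
  by rewrite sqr_normc_cdot /cdot -!expr2 lerDl lerDr !sqr_ge0.
split; split=> //; apply: (integrable_le _ _ int_n); try exact: measurable_funX;
  by move=> x; rewrite ger0_norm ?sqr_ge0//; have [] := le_n x.
Qed.

Lemma Lnorm2_lt u e : csqint mu u -> 0 < e ->
  (N2 u < e%:E)%E = (ip mu u u < e ^+ 2).
Proof.
move=> Lu e0; have := ip_sqr_normc Lu; rewrite -Lnorm2_sqr.
have := Lnorm_ge0 mu 2%:E (fun x => (normc (u x))%:E); rewrite -/(N2 u).
case: (N2 u) => [r r0| |//] => [[<-]|]; last by rewrite expeS.
by rewrite lte_fin -[X in _ = (X < _)]expr2 ltr_pXn2r// nnegrE// ltW.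
Qed.

End lnorm.

(** * Riesz bases on Euclidean space *)

Section ae_bound.
Context disp (T : measurableType disp) (R : realType).
Variable mu : {measure set T -> \bar R}.

(** The positive part of |g| - b is at most |g - h| for every h bounded by b,
    hence has square integral at most e for every e > 0. *)
Lemma ae_normc_le (g : T -> R[i]) (b : T -> R) :
  csqint mu g -> measurable_fun setT b ->
  (forall e : R, 0 < e -> exists h, [/\ csqint mu h, forall x, normc (h x) <= b x &
    ip mu (fun x => g x - h x) (fun x => g x - h x) <= e]) ->
  {ae mu, forall x, normc (g x) <= b x}.
Proof.
move=> Lg mb approx; pose phi x := Num.max 0 (normc (g x) - b x).
have mphi : measurable_fun setT phi.
  apply: measurable_maxr => //; apply: measurable_funB => //.
  by case: Lg => [[? _] [? _]]; exact: measurable_normc.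
have := @integral_sqr_small_ae0 _ _ _ mu phi mphi _.
move=> /(_ _)[e e0|N [mN N0 subN]].
  have [h [Lh hb gh]] := approx e e0.
  have Lgh := csqint_sub Lg Lh.
  apply: le_trans (_ : ((ip mu (fun x => g x - h x) (fun x => g x - h x))%:E <= e%:E)%E);
    last by rewrite lee_fin.
  rewrite -ip_sqr_normc//; apply: ge0_le_integral => //.
  - by move=> x _; rewrite lee_fin sqr_ge0.
  - by apply/measurable_EFinP; exact: measurable_funX.
  - apply/measurable_EFinP; apply: measurable_funX.
    by case: Lgh => [[? _] [? _]]; exact: measurable_normc.
  - move=> x _; rewrite lee_fin lerXn2r ?nnegrE ?le_max ?lexx ?normc_ge0//.
    rewrite ge_max normc_ge0/= lerBlDr.
    apply: le_trans (_ : normc (g x - h x) + normc (h x) <= _); last by rewrite lerD2l.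
    by rewrite -{1}(subrK (h x) (g x)) le_normcD.
exists N; split=> //; apply: subset_trans subN => x /= ngb phi0; apply: ngb.
have : phi x <= 0 by rewrite phi0.
by rewrite ge_max lexx/= subr_le0.
Qed.

End ae_bound.

Section euclidean_riesz.
Variables (R : realType) (d : nat).
Local Notation lam := (lebesgue R d).
Implicit Types (u v h : euclidean R d -> R[i]) (f g : lattice d -> euclidean R d -> R[i]).

Lemma L2_csqint u : L2 u -> csqint lam u.
Proof. by move=> [[mr mi] uoo]; exact: (Lnorm2_csqint mr mi uoo). Qed.

Lemma L2norm_lt u e : csqint lam u -> 0 < e ->
  (L2norm u < e%:E)%E = (ip lam u u < e ^+ 2).
Proof. by move=> Lu e0; exact: (Lnorm2_lt Lu e0). Qed.

Lemma finite_comb_complex_comb f (c : lattice d -> R[i]) (J : {fset lattice d}) :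
  finite_comb f c J = complex_comb (fun k : J => f (val k)) (fun k : J => c (val k)).
Proof. by apply/funext => x; rewrite /finite_comb big_seq_fsetE. Qed.

Lemma finite_comb_widen f (c : lattice d -> R[i]) (J J' : {fset lattice d}) :
  (J `<=` J')%fset -> (forall k, k \notin J -> c k = 0) ->
  finite_comb f c J' = finite_comb f c J.
Proof.
move=> JJ' c0; apply/funext => x; apply/esym/big_fset_incl => // k _ kJ.
by rewrite c0// mul0r.
Qed.

Lemma ell2norm_sqr_fset (c : lattice d -> R[i]) (J : {fset lattice d}) :
  (forall k, k \notin J -> c k = 0) ->
  ell2norm_sqr c = (\sum_(k : J) normc (c (val k)) ^+ 2)%:E.
Proof.
move=> c0; rewrite -(big_seq_fsetE _ J xpredT (fun k => normc (c k) ^+ 2))/= -sumEFin.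
rewrite fsbig_seq ?fset_uniq// -esum_fset//; last first.
  by move=> k _; rewrite lee_fin sqr_ge0.
rewrite [RHS]esum_mkcond; apply: eq_esum => k _.
case: ifPn => // kJ; rewrite c0 ?normc0 ?expr0n//.
by apply: contra kJ => kJ; rewrite inE.
Qed.

(** For coefficients vanishing outside J, the partial sums of the series are
    eventually the finite combination over J, so that the sum h of the series
    agrees with it up to a function of norm 0. *)
Lemma riesz_lower_fset f A B (J : {fset lattice d}) (c : J -> R[i]) :
  riesz_basis f A B ->
  A * \sum_k normc (c k) ^+ 2 <=
  ip lam (complex_comb (fun k : J => f (val k)) c)
         (complex_comb (fun k : J => f (val k)) c).
Proof.
move=> [A0 AB Lf rb]; pose c' k := oapp c 0 (insub k).
have c'E (k : J) : c' (val k) = c k by rewrite /c' valK.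
have c'0 k : k \notin J -> c' k = 0 by move=> kJ; rewrite /c' insubN.
have ell : ell2norm_sqr c' = (\sum_k normc (c k) ^+ 2)%:E.
  by rewrite (ell2norm_sqr_fset c'0); congr EFin; apply: eq_bigr => k _; rewrite c'E.
have [|h [Lh sum_h] [lower _]] := rb c'; first by rewrite ell ltry.
set w := complex_comb _ c.
have wE : finite_comb f c' J = w.
  by rewrite finite_comb_complex_comb; congr complex_comb; apply/funext => k; exact: c'E.
have {}Lh := L2_csqint Lh.
have Lw : csqint lam w.
  by rewrite /w complex_comb_real; apply: csqint_comb; apply: csqint_real_frame => k;
    exact: L2_csqint.
pose r x := h x - w x.
have Lr : csqint lam r := csqint_sub Lh Lw.
have r0 : ip lam r r = 0.
  apply/eqP; rewrite eq_le ip_ge0 andbT leNgt; apply/negP => rpos.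
  (* The tolerance is the norm of r itself, so that r would be smaller than
     its own norm. *)
  have [J0 /(_ (J0 `|` J)%fset)] :=
    sum_h (Num.sqrt (ip lam r r)) ltac:(by rewrite sqrtr_gt0).
  rewrite fsubsetUl (finite_comb_widen _ (fsubsetUr _ _) c'0) wE => /(_ isT).
  by rewrite (L2norm_lt Lr) ?sqrtr_gt0// sqr_sqrtr ?ltxx// ltW.
have hE : h = (fun x => r x + w x) by apply/funext => x; rewrite subrK.
have hh : ip lam h h = ip lam w w.
  by rewrite hE (ip_sqrD Lr Lw) r0 (ip_null Lr Lw r0) mulr0 !add0r.
have L2h : (L2norm h ^+ 2 = (ip lam h h)%:E)%E.
  by rewrite -(ip_sqr_normc Lh); exact: (Lnorm2_sqr lam h).
by move: lower; rewrite ell L2h hh -EFinM lee_fin.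
Qed.

(** Pairing with v and with i v in the real inner product gives the real and
    imaginary parts of the complex one. *)
Lemma L2inner_ip u v (b : bool) : L2inner u v = b%:R ->
  ip lam u v = b%:R /\ ip lam u (fun x => 'i%C * v x) = 0.
Proof.
move=> uv; have [re im] : complex.Re (L2inner u v) = b%:R /\ complex.Im (L2inner u v) = 0.
  by rewrite uv; case: b {uv}.
split; [rewrite -re|rewrite -[RHS]im]; apply: eq_Rintegral => x _; rewrite /cdot.
  by case: (u x) (v x) => [? ?] [? ?]/=; ring.
by case: (u x) (v x) => [? ?] [? ?]/=; ring.
Qed.

End euclidean_riesz.

Theorem theorem1 (R : realType) (d : nat) (hd : (1 <= d)%N) :
  exists E : R, 0 < E /\
    forall (C : R) (t : nat) (s : R),
      1 <= C -> (d < t)%N -> d%:R + t%:R < s ->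
    forall f : lattice d -> euclidean R d -> R[i],
      (forall k, cmeasurable (f k)) ->
      (forall k x, normc (f k x) <= C * (1 + max_dist x k) `^ (- s)) ->
    forall A B : R, riesz_basis f A B ->
    forall g : lattice d -> euclidean R d -> R[i], dual_basis f g ->
    let D := E ^+ (t ^ 2) * C ^+ (2 * t + 1) / A ^+ (t + 1)
             * (1 + 1 / (s - t%:R - d%:R)) ^+ t in
    forall k : lattice d,
      {ae lebesgue R d,
        forall x, normc (g k x) <= D * (1 + max_dist x k) ^- t}.
Proof.
exists (1024 * shell_const R d ^+ 3); split.
  apply: mulr_gt0; first by rewrite ltr0n.
  by rewrite exprn_gt0// mulr_gt0// exprn_gt0.
move=> C t s C1 dt dts f mf f_le A B rb g [g_span g_dual] D k.
have A0 : 0 < A by case: rb.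
have Lf j : csqint (lebesgue R d) (f j) by case: rb => _ _ Lf _; exact: L2_csqint.
have [L2g span_gk] := g_span k.
have Lg := L2_csqint L2g.
have b_meas : measurable_fun setT (fun x : euclidean R d => D * (1 + max_dist x k) ^- t).
  exact: (measurable_decay_bound D t (measurable_max_dist k) (fun x => max_dist_ge0 x k)).
apply: (@ae_normc_le _ _ _ (lebesgue R d) (g k) _ Lg b_meas) => e e0.
have se0 : 0 < Num.sqrt e by rewrite sqrtr_gt0.
have [c [J close]] := span_gk (Num.sqrt e) se0.
pose c1 l := if l \in J then c l else 0.
(* The projection argument needs k among the indices. *)
pose J' := (k |` J)%fset.
have combE : finite_comb f c J =
    complex_comb (fun l : J' => f (val l)) (fun l => c1 (val l)).
  rewrite -finite_comb_complex_comb (@finite_comb_widen _ _ f c1 J J') ?fsubsetUr//.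
    apply/funext => x; apply: eq_big_seq => l lJ; by rewrite /c1 lJ.
  by move=> l /negPf lJ; rewrite /c1 lJ.
have kJ : k \in J' by rewrite fset1U1.
pose k0 : J' := [` kJ]%fset.
have dual (l : J') := L2inner_ip (g_dual k (val l)).
have [||h [Lh h_le h_best]] := @finite_section_approximation _ _ R (lebesgue R d) d
  (fun x i => tnth x i) (@measurable_max_dist R d) (@integral_powRN_max_dist_le R d)
  C s t C1 dt dts J' (fun l => val l) val_inj (fun l => f (val l))
  (fun l => Lf (val l)) (fun l x => f_le (val l) x) A A0
  (fun c => riesz_lower_fset c rb) hd k0 (g k) Lg.
- by move=> l; rewrite (dual l).1 eq_sym -val_eqE.
- by move=> l; rewrite (dual l).2.
exists h; split=> //.
- move=> x; apply: le_trans (h_le x) _.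
  rewrite ler_wpM2r ?pointwise_const_le// invr_ge0 exprn_ge0// addr_ge0//.
  exact: max_dist_ge0.
- apply: le_trans (h_best (fun l => c1 (val l))) _; rewrite -combE.
  have Lcomb : csqint (lebesgue R d) (finite_comb f c J).
    rewrite finite_comb_complex_comb complex_comb_real; apply: csqint_comb.
    by apply: csqint_real_frame => l; exact: Lf.
  have := close; rewrite (L2norm_lt (csqint_sub Lg Lcomb) se0).
  by rewrite sqr_sqrtr ?(ltW e0)// => /ltW.
Qed.
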